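(* Let $H\in C(\mathbb R^d\times\mathbb R^d)$ satisfy assumptions (a), (b), (c) of the context. Let $u_0\in C^{0,1}(\mathbb R^d)$ and, for $\varepsilon>0$, let $u^\varepsilon$ and $u$ be the unique solutions (bounded and Lipschitz on $\mathbb R^d\times[0,T]$ for each $T>0$) of $$u^\varepsilon_t+H\left(Du^\varepsilon,\frac x\varepsilon\right)=0\quad\text{and}\quad u_t+\overline H(Du)=0$$ with initial condition $u^\varepsilon(x,0)=u(x,0)=u_0(x)$. Let $K>0$ be such that, for all $\varepsilon>0$, $x,y\in\mathbb R^d$ and $s,t\ge0$, $$\max\{|u^\varepsilon(x,t)-u^\varepsilon(y,s)|,\ |u(x,t)-u(y,s)|\}\le K(|x-y|+|t-s|).$$ Then there exists a constant $C>0$ such that, for all $T\ge1$ and $\varepsilon>0$, $$\sup_{(x,t)\in\mathbb R^d\times[0,T]}|u^\varepsilon(x,t)-u(x,t)|\le CT\left(\varepsilon^{1/3}+\eta_L(\varepsilon^{1/3})\right),\qquad L=L(K).$$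
   Context: $B_K$ is the open ball of radius $K$ centered at $0$ in $\mathbb R^d$. Equations hold in the viscosity sense. $C^{0,1}$ denotes bounded Lipschitz functions. Assumptions on $H\in C(\mathbb R^d\times\mathbb R^d)$, $H=H(p,y)$, required for each $K>0$ in (a) and (c): (a) $H$ is uniformly continuous on $B_K\times\mathbb R^d$ and $\{H(\cdot,y):y\in\mathbb R^d\}$ is bounded in $C^{0,1}(B_K)$; (b) $\lim_{|p|\to\infty}\inf_{y\in\mathbb R^d}H(p,y)=+\infty$; (c) (almost periodicity) $\{H(\cdot,\cdot+y):y\in\mathbb R^d\}$ is precompact in $C(B_K\times\mathbb R^d)$ in the uniform topology. For $\delta>0$, $p\in\mathbb R^d$, $v^\delta(\cdot\,;p)$ is the unique bounded uniformly continuous solution of $\delta v^\delta+H(p+Dv^\delta,y)=0$ in $\mathbb R^d$, and $\overline H\in C(\mathbb R^d)$ is the effective Hamiltonian, characterized by $\lim_{\delta\to0}\sup_{y\in\mathbb R^d}|\delta v^\delta(y\,;p)+\overline H(p)|=0$ for every $p$ (such $\overline H$ exists under (a)-(c)). For $K,R>0$, $$\rho_K(R):=\sup_{y\in\mathbb R^d}\inf_{z\in B_R}\sup_{(p,x)\in B_K\times\mathbb R^d}|H(p,x+y)-H(p,x+z)|,$$ for $\delta>0$, $\eta_K(\delta):=4\inf\{s>0:\rho_K(s/(K\delta))\le s\}$, and $$L(K):=\sup\left\{|q|:\ \inf_{y\in\mathbb R^d}H(q,y)\le\sup_{(p,y)\in B_K\times\mathbb R^d}H(p,y)\right\}.$$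 *)

(* Defs.v *)
From HB Require Import structures.
From mathcomp Require Export all_boot all_order all_algebra.
From mathcomp Require Export all_classical all_reals all_analysis.
Export Order.TTheory GRing.Theory Num.Theory numFieldNormedType.Exports.

Set Implicit Arguments.
Unset Strict Implicit.
Unset Printing Implicit Defensive.

Local Open Scope classical_set_scope.
Local Open Scope ring_scope.

(* The library norm on ['rV_d] is the max norm, whereas |x| is Euclidean. Both
   induce the same topology, so [continuous], [near], [differentiable],
   [unif_continuous] are used as they are; every quantitative use of |x| (balls,
   Lipschitz bounds, the constant L) goes through [enorm]. *)
Definition enorm (R : realType) (d : nat) (x : 'rV[R]_d) : R :=
  Num.sqrt (\sum_(i < d) x ord0 i ^+ 2).

Definition eball (R : realType) (d : nat) (r : R) : set 'rV[R]_d :=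
  [set x | enorm x < r].

Definition C1 (R : realType) (V : normedModType R) (f : V -> R) : Prop :=
  (forall x, differentiable f x) /\
  (forall h : V, continuous (fun x => 'd f x h)).

(* Viscosity solutions of F(x, u, Du) = 0 in an open set [Om]: [F] receives the
   point, the value of [u] and the differential of the C^1 test function. *)
Definition viscosity_subsolution (R : realType) (V : normedModType R)
    (Om : set V) (F : V -> R -> (V -> R) -> R) (u : V -> R) : Prop :=
  forall (phi : V -> R) (x : V), C1 phi -> Om x ->
    (\forall y \near x, u y - phi y <= u x - phi x) ->
    F x (u x) ('d phi x) <= 0.

Definition viscosity_supersolution (R : realType) (V : normedModType R)
    (Om : set V) (F : V -> R -> (V -> R) -> R) (u : V -> R) : Prop :=
  forall (phi : V -> R) (x : V), C1 phi -> Om x ->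
    (\forall y \near x, u x - phi x <= u y - phi y) ->
    0 <= F x (u x) ('d phi x).

Definition viscosity_solution (R : realType) (V : normedModType R)
    (Om : set V) (F : V -> R -> (V -> R) -> R) (u : V -> R) : Prop :=
  [/\ {in Om, continuous u},
      viscosity_subsolution Om F u & viscosity_supersolution Om F u].

(* delta v + H(p + Dv, y) = 0 in R^d *)
Definition cell_solution (R : realType) (d : nat)
    (H : 'rV[R]_d -> 'rV[R]_d -> R) (delta : R) (p : 'rV[R]_d)
    (v : 'rV[R]_d -> R) : Prop :=
  viscosity_solution setT
    (fun y r (l : 'rV[R]_d -> R) =>
       delta * r + H (p + \row_(i < d) l (delta_mx ord0 i)) y)
    v.

(* u_t + G(Du, x) = 0 in R^d x (0, oo); values of [u x t] for t < 0 are
   irrelevant. *)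
Definition evolution_solution (R : realType) (d : nat)
    (G : 'rV[R]_d -> 'rV[R]_d -> R) (u : 'rV[R]_d -> R -> R) : Prop :=
  viscosity_solution [set z : 'rV[R]_d * R | 0 < z.2]
    (fun z _ (l : 'rV[R]_d * R -> R) =>
       l (0, 1) + G (\row_(i < d) l (delta_mx ord0 i, 0)) z.1)
    (fun z => u z.1 z.2).

(* [f] lies in C^{0,1}(A), with sup norm and Lipschitz constant at most [M]. *)
Definition C01_bound (R : realType) (d : nat) (A : set 'rV[R]_d) (M : R)
    (f : 'rV[R]_d -> R) : Prop :=
  (forall x, A x -> `|f x| <= M) /\
  (forall x y, A x -> A y -> `|f x - f y| <= M * enorm (x - y)).

Definition C01_strip (R : realType) (d : nat) (T : R)
    (u : 'rV[R]_d -> R -> R) : Prop :=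
  exists M : R,
    (forall x t, 0 <= t <= T -> `|u x t| <= M) /\
    (forall x y s t, 0 <= s <= T -> 0 <= t <= T ->
       `|u x t - u y s| <= M * (enorm (x - y) + `|t - s|)).

Definition assumption_a (R : realType) (d : nat)
    (H : 'rV[R]_d -> 'rV[R]_d -> R) : Prop :=
  forall K : R, 0 < K ->
    (forall e : R, 0 < e -> exists2 r : R, 0 < r &
       forall p p' y y' : 'rV[R]_d, eball K p -> eball K p' ->
         enorm (p - p') < r -> enorm (y - y') < r ->
         `|H p y - H p' y'| < e) /\
    (exists M : R, forall y : 'rV[R]_d, C01_bound (eball K) M (H^~ y)).

Definition assumption_b (R : realType) (d : nat)
    (H : 'rV[R]_d -> 'rV[R]_d -> R) : Prop :=
  forall M : R, exists r : R, forall p : 'rV[R]_d, r < enorm p ->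
    (M%:E <= ereal_inf [set (H p y)%:E | y in setT])%E.

(* The uniform structure of [{uniform` A -> R}] ignores values outside [A], and
   uniform limits of continuous functions are continuous on [A], so this is
   precompactness in C(B_K x R^d). *)
Definition assumption_c (R : realType) (d : nat)
    (H : 'rV[R]_d -> 'rV[R]_d -> R) : Prop :=
  forall K : R, 0 < K ->
    precompact
      ([set (fun z : 'rV[R]_d * 'rV[R]_d => H z.1 (z.2 + y)) | y in setT]
        : set {uniform` (@eball R d K `*` setT) -> R}).

(* [rho H K r] is rho_K(r), computed in the extended reals. *)
Definition rho (R : realType) (d : nat) (H : 'rV[R]_d -> 'rV[R]_d -> R)
    (K r : R) : \bar R :=
  ereal_sup [set
    ereal_inf [set
      ereal_sup [set (`|H px.1 (px.2 + y) - H px.1 (px.2 + z)|)%:E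
                | px in @eball R d K `*` setT]
      | z in @eball R d r]
    | y in setT].

(* For K, delta > 0, (a) makes rho_K bounded, so the set below is nonempty and
   the real [inf] is a genuine infimum. *)
Definition eta (R : realType) (d : nat) (H : 'rV[R]_d -> 'rV[R]_d -> R)
    (K delta : R) : R :=
  4 * inf [set s : R | 0 < s /\ (rho H K (s / (K * delta)) <= s%:E)%E].

(* For K > 0 the set below contains B_K and is bounded by (a) and (b), so the
   real [sup] is a genuine supremum. *)
Definition Lconst (R : realType) (d : nat) (H : 'rV[R]_d -> 'rV[R]_d -> R)
    (K : R) : R :=
  sup [set enorm q | q in [set q : 'rV[R]_d |
    (ereal_inf [set (H q y)%:E | y in setT] <=
     ereal_sup [set (H py.1 py.2)%:E | py in @eball R d K `*` setT])%E]].

Definition cell_family (R : realType) (d : nat)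
    (H : 'rV[R]_d -> 'rV[R]_d -> R)
    (v : R -> 'rV[R]_d -> 'rV[R]_d -> R) : Prop :=
  forall (delta : R) (p : 'rV[R]_d), 0 < delta ->
    [/\ exists M : R, forall y, `|v delta p y| <= M,
        unif_continuous (v delta p) &
        cell_solution H delta p (v delta p)].

Definition effective_hamiltonian (R : realType) (d : nat)
    (v : R -> 'rV[R]_d -> 'rV[R]_d -> R) (Hbar : 'rV[R]_d -> R) : Prop :=
  continuous Hbar /\
  forall p : 'rV[R]_d,
    ereal_sup [set (`|delta * v delta p y + Hbar p|)%:E | y in setT]
      @[delta --> 0^'+] --> 0%E.

(* Main.v *)
From HB Require Import structures.
Require Import Defs.
From mathcomp Require Import ring lra.

Set Implicit Arguments.
Unset Strict Implicit.
Unset Printing Implicit Defensive.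

Local Open Scope classical_set_scope.
Local Open Scope ring_scope.

(** Write [delta] for [eps^(1/3)] and let [s] be an admissible number in the
    infimum defining [eta], so that [rho_L (s / (L delta)) <= s].

    _Approximate correctors._ Fix [|p| <= K] and let [v] solve the cell problem.
    Comparison with constants gives [- delta v <= S], with [S] the supremum of [H]
    over the ball of radius [K]; hence wherever [v] is touched from above with
    gradient [q], [H (p + q) y <= S] and [|p + q| <= L].  So [v] is Lipschitz and
    only sees [H] at momenta of length at most [L].  If the shift by [c] changes [H]
    by at most [N] at these momenta, comparing [v] with its translate shows that
    [delta v] changes by at most [N] under the same shift.  Every point is such an
    almost-period, with [N] close to [s], up to a displacement of length
    [s / (L delta)], along which the Lipschitz function [delta v] moves by a
    multiple of [s].  Therefore [delta v] oscillates by at most [C s]; since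
    [- Hbar p] lies between its infimum and supremum (compare [v] with the
    solutions for smaller [delta]), [|delta v + Hbar p| <= C s].  This is
    [corrector_error]; everything in it rests on [cell_comparison].

    _Doubling of variables._ To bound [f - g], with [f] and [g] the oscillating and
    the homogenized solutions, maximize
    [f x t - g y s - |x - y|^2 / (2 delta) - (t - s)^2 / (2 delta) - gam t],
    set [p := (x - y) / delta] at the maximum, and then maximize again with this
    [p] frozen after subtracting [eps v(z; p)], a penalty forcing [z] to be close to
    [x / eps], and [|x - y - delta p|^2 / (2 delta)].  Between the two maxima the
    functional changes by at most the oscillation [eps C s / delta] of the corrector
    term, so [|x - y - delta p|^2 / delta <= 2 eps C s / delta]: the gradients seen by
    the three equations differ from [p], and from [p + Dv], by a multiple of
    [sqrt (eps s) / delta = sqrt (delta s) <= delta + s].  The equations for [f], [g]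
    and [v] then give [gam <= C (delta + s)], so that a larger [gam] is impossible
    and [f - g <= C T (delta + s)].  This is [perturbed_doubling] followed by
    [one_sided_rate].

    Replacing [f], [g], [v(.; p)], [H p y] by [- f], [- g], [- v(.; - p)],
    [- H (- p) y] exchanges sub- and supersolutions, so the same statement bounds
    [g - f].  Taking [s] close to the infimum gives the rate for [eps <= 1]; for
    [eps > 1] the Lipschitz bound in time suffices.

    All penalties are quadratic.  The viscosity inequalities are therefore only
    used on paraboloids, through the jets [superjet] and [superjet_t]. *)

(** * Euclidean geometry of row vectors *)

Section Euclid.
Context {R : realType} {d : nat}.
Implicit Types (x y z q : 'rV[R]_d) (a b : R).

Definition dot x y : R := \sum_(i < d) x ord0 i * y ord0 i.

Lemma dotC x y : dot x y = dot y x.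
Proof. by apply: eq_bigr => i _; rewrite mulrC. Qed.

Lemma dotDl x y z : dot (x + y) z = dot x z + dot y z.
Proof. by rewrite -big_split; apply: eq_bigr => i _; rewrite !mxE mulrDl. Qed.

Lemma dotZl a x z : dot (a *: x) z = a * dot x z.
Proof. by rewrite /dot big_distrr; apply: eq_bigr => i _; rewrite !mxE /= mulrA. Qed.

Lemma dotNl x z : dot (- x) z = - dot x z.
Proof. by rewrite -scaleN1r dotZl mulN1r. Qed.

Lemma dotDr x y z : dot z (x + y) = dot z x + dot z y.
Proof. by rewrite dotC dotDl !(dotC z). Qed.

Lemma dotZr a x z : dot z (a *: x) = a * dot z x.
Proof. by rewrite dotC dotZl dotC. Qed.

Lemma dotNr x z : dot z (- x) = - dot z x.
Proof. by rewrite dotC dotNl dotC. Qed.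

Lemma dot0r z : dot z 0 = 0.
Proof. by rewrite -(scale0r (0 : 'rV[R]_d)) dotZr mul0r. Qed.

Definition dotE := (dotDl, dotDr, dotNl, dotNr, dotZl, dotZr).

Lemma dotxx_ge0 x : 0 <= dot x x.
Proof. by apply: sumr_ge0 => i _; rewrite -expr2 sqr_ge0. Qed.

Lemma sqr_enorm x : enorm x ^+ 2 = dot x x.
Proof.
by rewrite sqr_sqrtr; [apply: eq_bigr => i _; rewrite expr2
                      |apply: sumr_ge0 => i _; exact: sqr_ge0].
Qed.

Lemma enorm_ge0 x : 0 <= enorm x.
Proof. exact: sqrtr_ge0. Qed.

Lemma enormZ a x : enorm (a *: x) = `|a| * enorm x.
Proof.
apply: (@pexpIrn _ 2) => //; rewrite ?nnegrE ?mulr_ge0 ?enorm_ge0//.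
by rewrite exprMn !sqr_enorm !dotE real_normK ?num_real// expr2 mulrA.
Qed.

Lemma enormN x : enorm (- x) = enorm x.
Proof. by rewrite -scaleN1r enormZ normrN normr1 mul1r. Qed.

Lemma enorm0 : enorm (0 : 'rV[R]_d) = 0.
Proof. by rewrite -(scale0r (0 : 'rV[R]_d)) enormZ normr0 mul0r. Qed.

Lemma enormB x y : enorm (x - y) = enorm (y - x).
Proof. by rewrite -enormN opprB. Qed.

(** Cauchy-Schwarz, from the sign of the squared length of [|y| x - |x| y]. *)
Lemma dot_le x y : dot x y <= enorm x * enorm y.
Proof.
have [x0|x0] := eqVneq (enorm x) 0.
  suff -> : dot x y = 0 by rewrite x0 mul0r.
  have := sqr_enorm x; rewrite x0 expr0n /= => /esym/eqP.
  rewrite psumr_eq0; last by move=> i _; rewrite -expr2 sqr_ge0.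
  move=> /allP xi0; rewrite /dot big1// => i _.
  have /= := xi0 i (mem_index_enum _).
  by rewrite mulf_eq0 orbb => /eqP ->; rewrite mul0r.
have [y0|y0] := eqVneq (enorm y) 0.
  suff -> : dot x y = 0 by rewrite y0 mulr0.
  have := sqr_enorm y; rewrite y0 expr0n /= => /esym/eqP.
  rewrite psumr_eq0; last by move=> i _; rewrite -expr2 sqr_ge0.
  move=> /allP xi0; rewrite /dot big1// => i _.
  have /= := xi0 i (mem_index_enum _).
  by rewrite mulf_eq0 orbb => /eqP ->; rewrite mulr0.
have xp : 0 < enorm x by rewrite lt_neqAle eq_sym x0 enorm_ge0.
have yp : 0 < enorm y by rewrite lt_neqAle eq_sym y0 enorm_ge0.
have := dotxx_ge0 (enorm y *: x - enorm x *: y).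
rewrite !dotE (dotC y x) -!sqr_enorm => h.
rewrite -(ler_pM2l (mulr_gt0 xp yp)); nra.
Qed.

Lemma enormD x y : enorm (x + y) <= enorm x + enorm y.
Proof.
rewrite -(@ler_pXn2r _ 2)// ?nnegrE ?addr_ge0 ?enorm_ge0//.
rewrite sqr_enorm !dotE (dotC y x) -!sqr_enorm.
by have := dot_le x y; nra.
Qed.

Lemma coord_le_enorm x i : `|x ord0 i| <= enorm x.
Proof.
rewrite -(@ler_pXn2r _ 2)// ?nnegrE ?enorm_ge0//.
rewrite sqr_enorm real_normK ?num_real// /dot (bigD1 i)//= -expr2 lerDl.
by apply: sumr_ge0 => j _; rewrite -expr2 sqr_ge0.
Qed.

Lemma norm_le_enorm x : `|x| <= enorm x.
Proof.
rewrite [leLHS]/Num.norm /= mx_normrE; apply/bigmax_leP; split; first exact: enorm_ge0.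
by move=> [i j] _ /=; rewrite ord1 coord_le_enorm.
Qed.

Lemma sqr_enormD x y :
  enorm (x + y) ^+ 2 = enorm x ^+ 2 + 2 * dot x y + enorm y ^+ 2.
Proof. rewrite !sqr_enorm !dotE (dotC y x); ring. Qed.

Lemma continuous_dot (T : topologicalType) (f g : T -> 'rV[R]_d) :
  continuous f -> continuous g -> continuous (fun t => dot (f t) (g t)).
Proof.
move=> cf cg; apply: continuous_big => [|i _ t]; first exact: add_continuous.
apply: cvgM.
- by apply: (@continuous_comp _ _ _ f (fun x : 'rV[R]_d => x ord0 i)); [exact: cf|exact: coord_continuous].
- by apply: (@continuous_comp _ _ _ g (fun x : 'rV[R]_d => x ord0 i)); [exact: cg|exact: coord_continuous].
Qed.

Lemma continuous_sqr_enorm (T : topologicalType) (f : T -> 'rV[R]_d) :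
  continuous f -> continuous (fun t => enorm (f t) ^+ 2).
Proof.
move=> cf; rewrite (_ : (fun _ => _) = (fun t => dot (f t) (f t))).
  exact: continuous_dot.
by apply/funext => t; rewrite sqr_enorm.
Qed.

Lemma continuous_enorm (T : topologicalType) (f : T -> 'rV[R]_d) :
  continuous f -> continuous (fun t => enorm (f t)).
Proof.
move=> cf; rewrite (_ : (fun _ => _) = (fun t => Num.sqrt (dot (f t) (f t)))).
  move=> t; apply: (@continuous_comp _ _ _ (fun t => dot (f t) (f t)) Num.sqrt).
    exact: continuous_dot.
  exact: sqrt_continuous.
by apply/funext => t; rewrite -sqr_enorm sqrtr_sqr ger0_norm ?enorm_ge0.
Qed.

End Euclid.

(** * Paraboloids as test functions *)

Section C1Calculus.
Context {R : realType} {V : normedModType R}.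

(** [C1] together with a candidate differential, so that the calculus rules
    compute the differential of a test function along with its regularity. *)
Definition C1_with (f : V -> R) (df : V -> V -> R) : Prop :=
  (forall x, is_diff x f (df x)) /\ (forall h, continuous (fun x => df x h)).

Lemma C1_withP f df : C1_with f df ->
  C1 f /\ forall x, 'd f x = df x :> (V -> R).
Proof.
move=> [fdf cdf]; have E x : 'd f x = df x :> (V -> R).
  by have fx := fdf x; rewrite diff_val.
split=> //; split=> [x|h]; first by have [] := fdf x.
by rewrite (_ : (fun x => _) = df ^~ h)//; apply/funext => x; rewrite E.
Qed.

Lemma C1_with_eq f g df dg : C1_with f df -> f =1 g -> df =2 dg -> C1_with g dg.
Proof.
move=> fdf fg dfg; have <- : f = g by apply/funext.
by have <- : df = dg by apply/funext => x; apply/funext => h.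
Qed.

Lemma C1_with_cst (c : R) : C1_with (fun _ => c) (fun _ _ => 0).
Proof. by split=> [x|h x]; [exact: is_diff_cst|exact: cvg_cst]. Qed.

Lemma C1_with_linear (l : V -> R) :
  linear l -> continuous l -> C1_with l (fun _ => l).
Proof.
move=> ll cl; pose lM := GRing.isLinear.Build _ _ _ _ _ ll.
pose L : {linear V -> R} := HB.pack l lM.
split=> [x|h x]; last exact: cvg_cst.
by apply: DiffDef; [exact: (@linear_differentiable _ _ _ L)
                   |exact: (@diff_lin _ _ _ L)].
Qed.

Lemma C1_withD f g df dg : C1_with f df -> C1_with g dg ->
  C1_with (fun x => f x + g x) (fun x h => df x h + dg x h).
Proof.
move=> [fdf cf] [gdg cg]; split=> [x|h x].
- by have ? := fdf x; have ? := gdg x; exact: is_diffD.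
- by apply: cvgD; [exact: cf|exact: cg].
Qed.

Lemma C1_withM f g df dg : C1_with f df -> C1_with g dg ->
  C1_with (fun x => f x * g x) (fun x h => f x * dg x h + g x * df x h).
Proof.
move=> [fdf cf] [gdg cg]; split=> [x|h x].
- by have ? := fdf x; have ? := gdg x; exact: is_diffM.
- have cdf : {for x, continuous f} by apply: differentiable_continuous; case: (fdf x).
  have cdg : {for x, continuous g} by apply: differentiable_continuous; case: (gdg x).
  by apply: cvgD; apply: cvgM => //; [exact: cg|exact: cf].
Qed.

Lemma C1_with_sum n (f : 'I_n -> V -> R) df :
  (forall i, C1_with (f i) (df i)) ->
  C1_with (fun x => \sum_(i < n) f i x) (fun x h => \sum_(i < n) df i x h).
Proof.
elim: n f df => [|n IH] f df fdf.
  by apply: (C1_with_eq (C1_with_cst 0)) => [x|x h]; rewrite big_ord0.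
apply: (C1_with_eq (C1_withD (fdf ord0) (IH _ _ (fun i => fdf (lift ord0 i))))).
- by move=> x; rewrite big_ord_recl.
- by move=> x h; rewrite big_ord_recl.
Qed.

(** Stated for arbitrary linear coordinates [l i], so that row vectors and
    space-time are both instances; the squares do not contribute at [z]. *)
Lemma paraboloid_C1 n (l : 'I_n -> V -> R) (q : 'I_n -> R) (B : R) z :
  (forall i, linear (l i)) -> (forall i, continuous (l i)) ->
  let phi x := \sum_(i < n) (q i * l i (x - z) + B * (l i (x - z) * l i (x - z))) in
  C1 phi /\ 'd phi z = (fun h => \sum_(i < n) q i * l i h) :> (V -> R).
Proof.
move=> ll cl phi.
have lB i x y : l i (x - y) = l i x - l i y.
  by rewrite addrC -scaleN1r ll scaleN1r addrC.
have li i : C1_with (fun x => l i x + - l i z) (fun _ h => l i h + 0).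
  by apply: C1_withD; [exact: C1_with_linear|exact: C1_with_cst].
have lz i : C1_with (fun x => l i (x - z)) (fun _ h => l i h).
  by apply: (C1_with_eq (li i)) => [x|x h]; rewrite ?lB ?addr0.
have /C1_withP[Cphi dphi] := C1_with_sum (fun i => C1_withD
  (C1_withM (C1_with_cst (q i)) (lz i))
  (C1_withM (C1_with_cst B) (C1_withM (lz i) (lz i)))).
split=> //; rewrite dphi; apply/funext=> h; apply: eq_bigr => i _.
rewrite lB !subrr; ring.
Qed.

End C1Calculus.

(** * Quadratic jets *)

Section Jets.
Context {R : realType} {d : nat}.
Implicit Types (x y z q : 'rV[R]_d) (v : 'rV[R]_d -> R) (f : 'rV[R]_d -> R -> R).

(** The inequality is global and its second-order part is a multiple of the square
    of the norm: maxima of quadratically penalized functions provide exactly this,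
    and [x |-> dot q (x - y) + B |x - y|^2] is then a test function. *)
Definition superjet v y q := exists B : R, forall x,
  v x <= v y + dot q (x - y) + B * enorm (x - y) ^+ 2.

Definition subjet v y q := superjet (fun x => - v x) y (- q).

(** The time constraint [0 <= s] reflects that the maxima below are taken over
    nonnegative times; it still covers a neighbourhood of any positive time. *)
Definition superjet_t f x t q (a : R) := exists B : R, forall y s, 0 <= s ->
  f y s <= f x t + dot q (y - x) + a * (s - t)
           + B * (enorm (y - x) ^+ 2 + (s - t) ^+ 2).

Definition subjet_t f x t q (a : R) :=
  superjet_t (fun x t => - f x t) x t (- q) (- a).

Lemma superjet_test q y (B : R) :
  let phi x := dot q (x - y) + B * enorm (x - y) ^+ 2 in
  C1 phi /\ \row_(i < d) 'd phi y (delta_mx ord0 i) = q.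
Proof.
move=> phi.
have [|i|Cphi dphi] := @paraboloid_C1 R _ d (fun i x => x ord0 i) (q ord0) B y.
- by move=> i a x z; rewrite !mxE.
- exact: coord_continuous.
rewrite (_ : phi = fun x => \sum_(i < d) (q ord0 i * (x - y) ord0 i +
   B * ((x - y) ord0 i * (x - y) ord0 i))); last first.
  by apply/funext=> x; rewrite big_split /= -big_distrr /phi sqr_enorm.
split=> //; rewrite dphi; apply/rowP => i; rewrite mxE (bigD1 i)//= mxE !eqxx mulr1.
by rewrite big1 ?addr0// => j ji; rewrite mxE (negbTE ji) andbF mulr0.
Qed.

(** The linear coordinates are those of ['rV_d] preceded by time, at index [ord0]. *)
Lemma superjet_t_test q x t (a B : R) :
  let phi (z : 'rV[R]_d * R) := dot q (z.1 - x) + a * (z.2 - t)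
            + B * (enorm (z.1 - x) ^+ 2 + (z.2 - t) ^+ 2) in
  [/\ C1 phi, \row_(i < d) 'd phi (x, t) (delta_mx ord0 i, 0) = q &
      'd phi (x, t) (0, 1) = a].
Proof.
move=> phi.
pose l (i : 'I_d.+1) (z : 'rV[R]_d * R) :=
  if unlift ord0 i is Some j then z.1 ord0 j else z.2.
pose p (i : 'I_d.+1) := if unlift ord0 i is Some j then q ord0 j else a.
have [||Cphi dphi] := @paraboloid_C1 R _ d.+1 l p B (x, t).
- by move=> i b y z; rewrite /l; case: unliftP => [j|] _ //=; rewrite !mxE.
- move=> i; rewrite /l; case: unliftP => [j|] _ z /=; last exact: cvg_snd.
  apply: (@continuous_comp _ _ _ fst (fun x : 'rV[R]_d => x ord0 j)).
    exact: cvg_fst.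
  exact: coord_continuous.
rewrite (_ : phi = fun z : 'rV[R]_d * R => \sum_(i < d.+1) (p i * l i (z - (x, t)) +
   B * (l i (z - (x, t)) * l i (z - (x, t))))); last first.
  apply/funext=> z; rewrite big_ord_recl /p /l unlift_none /=.
  under eq_bigr do rewrite liftK.
  by rewrite big_split /= -big_distrr /phi sqr_enorm -/(dot _ _) -/(dot _ _) /=; ring.
split=> //; rewrite dphi.
  apply/rowP => i; rewrite mxE big_ord_recl /p /l unlift_none /= mulr0 add0r.
  under eq_bigr do rewrite liftK.
  rewrite (bigD1 i)//= mxE !eqxx mulr1.
  by rewrite big1 ?addr0// => j ji; rewrite mxE (negbTE ji) andbF mulr0.
rewrite big_ord_recl /p /l unlift_none /= mulr1 big1 ?addr0// => j _.
by rewrite liftK mxE mulr0.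
Qed.

Lemma cell_superjet (H : 'rV[R]_d -> 'rV[R]_d -> R) delta p v y q :
  cell_solution H delta p v -> superjet v y q -> delta * v y + H (p + q) y <= 0.
Proof.
move=> [_ vsub _] [B vB]; have [Cphi dphi] := superjet_test q y B.
have := vsub _ y Cphi I; rewrite dphi; apply.
near=> x; rewrite subrr dot0r enorm0 expr0n /= mulr0 addr0 subr0.
have := vB x; lra.
Unshelve. all: by end_near. Qed.

Lemma cell_subjet (H : 'rV[R]_d -> 'rV[R]_d -> R) delta p v y q :
  cell_solution H delta p v -> subjet v y q -> 0 <= delta * v y + H (p + q) y.
Proof.
move=> [_ _ vsup] [B vB]; have [Cphi dphi] := superjet_test q y (- B).
have := vsup _ y Cphi I; rewrite dphi; apply.
near=> x; rewrite subrr dot0r enorm0 expr0n /= mulr0 addr0 subr0.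
have := vB x; rewrite dotNl; lra.
Unshelve. all: by end_near. Qed.

Lemma open_time : open [set z : 'rV[R]_d * R | 0 < z.2].
Proof.
rewrite (_ : [set _ | _] = snd @^-1` [set t : R | 0 < t])//.
by apply: open_comp; [move=> *; exact: cvg_snd|exact: open_gt].
Qed.

Lemma evolution_superjet (G : 'rV[R]_d -> 'rV[R]_d -> R) f x t q a :
  evolution_solution G f -> 0 < t -> superjet_t f x t q a -> a + G q x <= 0.
Proof.
move=> [_ fsub _] t0 [B fB]; have [Cphi qphi aphi] := superjet_t_test q x t a B.
have := fsub _ (x, t) Cphi t0; rewrite qphi aphi; apply.
have := open_nbhs_nbhs (conj open_time (t0 : [set z : 'rV[R]_d * R | 0 < z.2] (x, t))).
apply: filterS => -[y s] /= s0.
rewrite !subrr dot0r enorm0 expr0n /= !(mulr0, addr0, subr0).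
have := fB y s (ltW s0); lra.
Qed.

Lemma evolution_subjet (G : 'rV[R]_d -> 'rV[R]_d -> R) f x t q a :
  evolution_solution G f -> 0 < t -> subjet_t f x t q a -> 0 <= a + G q x.
Proof.
move=> [_ _ fsup] t0 [B fB]; have [Cphi qphi aphi] := superjet_t_test q x t a (- B).
have := fsup _ (x, t) Cphi t0; rewrite qphi aphi; apply.
have := open_nbhs_nbhs (conj open_time (t0 : [set z : 'rV[R]_d * R | 0 < z.2] (x, t))).
apply: filterS => -[y s] /= s0.
rewrite !subrr dot0r enorm0 expr0n /= !(mulr0, addr0, subr0).
have := fB y s (ltW s0); rewrite dotNl; lra.
Qed.

(** Moving from [y] against the gradient [q] by a small step [r q] lowers [v] by
    about [r |q|^2], but by at most [K r |q|]. *)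
Lemma superjet_lip v y q (K : R) : 0 <= K ->
  (forall x, v y - K * enorm (x - y) <= v x) -> superjet v y q -> enorm q <= K.
Proof.
move=> K0 vK [B vB]; rewrite leNgt; apply/negP => Kq.
set n := enorm q in Kq *.
have n0 : 0 < n by lra.
pose r := (n - K) / (2 * n * (`|B| + 1)).
have r0 : 0 < r by rewrite divr_gt0 ?mulr_gt0//; have := normr_ge0 B; lra.
have hr : r * n * (`|B| + 1) = (n - K) / 2.
  by rewrite /r; field; rewrite gt_eqF//=; have := normr_ge0 B; lra.
have := vB (y - r *: q); have := vK (y - r *: q).
rewrite (_ : y - r *: q - y = - (r *: q)); last by rewrite addrC addKr.
rewrite enormN enormZ dotNr dotZr -sqr_enorm -/n (gtr0_norm r0) => h1 h2.
clearbody r n.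
have h3 : r * n * (n - K) <= r * n * (r * n * B) by nra.
have h4 : n - K <= r * n * B by rewrite -(ler_pM2l (mulr_gt0 r0 n0)).
have h5 : r * n * B <= r * n * (`|B| + 1).
  by rewrite ler_pM2l ?mulr_gt0//; have := ler_norm B; lra.
lra.
Qed.

End Jets.

(** Identities between row vectors, coordinate by coordinate. *)
Ltac row_ring := by apply/rowP => ?; rewrite !mxE; ring.

(** * Attained maxima *)

Section Maxima.
Context {R : realType} {d : nat}.
Local Notation V := 'rV[R]_d.

Lemma sqr_enorm_shift (x y w : V) :
  enorm (x - w) ^+ 2 =
  enorm (y - w) ^+ 2 + 2 * dot (y - w) (x - y) + enorm (x - y) ^+ 2.
Proof. by rewrite -sqr_enormD [_ + (x - y)]addrC addrA subrK. Qed.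

Lemma sqr_enorm_shiftN (x y w : V) :
  enorm (w - x) ^+ 2 =
  enorm (w - y) ^+ 2 - 2 * dot (w - y) (x - y) + enorm (x - y) ^+ 2.
Proof.
rewrite (_ : w - x = (w - y) - (x - y)); last by row_ring.
by rewrite sqr_enormD dotNr mulrN enormN.
Qed.

Lemma compact_box (B : R) : compact [set x : V | forall i, `[- B, B]%classic (x ord0 i)].
Proof.
by apply: (@rV_compact _ _ (fun=> `[- B, B]%classic)) => i; exact: segment_compact.
Qed.

(** A continuous function whose superlevel set at one base point is bounded attains
    its maximum over nonnegative times.  Five variables serve both doubling
    arguments: two copies of space-time and the fast variable [z]. *)
Lemma coercive_max (F : V * V * V * R * R -> R) (x0 y0 z0 : V) (t0 s0 B : R) :
  continuous F -> 0 <= t0 -> 0 <= s0 ->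
  (forall x y z t s, 0 <= t -> 0 <= s ->
     F (x0, y0, z0, t0, s0) <= F (x, y, z, t, s) ->
     [/\ enorm x <= B, enorm y <= B, enorm z <= B, t <= B & s <= B]) ->
  exists x y z t s, [/\ 0 <= t, 0 <= s &
    forall x' y' z' t' s', 0 <= t' -> 0 <= s' ->
      F (x', y', z', t', s') <= F (x, y, z, t, s)].
Proof.
move=> cF t00 s00 FB.
pose K := [set x : V | forall i, `[- B, B]%classic (x ord0 i)].
pose A := K `*` K `*` K `*` `[0, B]%classic `*` `[0, B]%classic.
have KP x : enorm x <= B -> K x.
  move=> xB i; rewrite /= in_itv /= -ler_norml.
  exact: le_trans (coord_le_enorm _ _) xB.
have inA x y z t s : 0 <= t -> 0 <= s ->
    F (x0, y0, z0, t0, s0) <= F (x, y, z, t, s) -> A (x, y, z, t, s).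
  move=> t_ge0 s_ge0 /(FB _ _ _ _ _ t_ge0 s_ge0)[xB yB zB tB sB].
  by rewrite /A /= !in_itv /= t_ge0 s_ge0 tB sB; do !split; exact: KP.
have A0 : A (x0, y0, z0, t0, s0) by exact: inA.
have cA : compact A.
  by do 4?[apply: compact_setX]; do ?[exact: compact_box|exact: segment_compact].
have [|p pA pmax] := compact_EVT_max (A := A) _ cA (continuous_subspaceT cF).
  by exists (x0, y0, z0, t0, s0).
move: p pA pmax => [[[[x y] z] t] s]; rewrite inE => Ap pmax.
have [[_ /=]] := Ap; rewrite !in_itv /= => /andP[t_ge0 _] /andP[s_ge0 _].
exists x, y, z, t, s; split=> // x' y' z' t' s' t'0 s'0.
have [h|/ltW h] := leP (F (x0, y0, z0, t0, s0)) (F (x', y', z', t', s')).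
  by apply: pmax; rewrite inE; exact: inA.
by apply: le_trans h _; apply: pmax; rewrite inE.
Qed.

End Maxima.

(** [continuous] is a notation for a quantified formula; the name makes the
    shape of the function visible to syntactic matching. *)
Definition cts_fun {T U : topologicalType} (f : T -> U) : Prop := continuous f.

Section ContinuityRules.
Context {R : realType} {T : topologicalType}.

Lemma ctsD (W : normedModType R) (f g : T -> W) :
  cts_fun f -> cts_fun g -> cts_fun (fun x => f x + g x).
Proof. by move=> cf cg x; apply: cvgD; [exact: cf|exact: cg]. Qed.

Lemma ctsN (W : normedModType R) (f : T -> W) :
  cts_fun f -> cts_fun (fun x => - f x).
Proof. by move=> cf x; apply: cvgN; exact: cf. Qed.

Lemma ctsM (f g : T -> R) :
  cts_fun f -> cts_fun g -> cts_fun (fun x => f x * g x).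
Proof. by move=> cf cg x; apply: cvgM; [exact: cf|exact: cg]. Qed.

Lemma ctsX (f : T -> R) n : cts_fun f -> cts_fun (fun x => f x ^+ n).
Proof.
move=> cf; elim: n => [|n IH]; first by move=> x; exact: cvg_cst.
by rewrite (_ : (fun _ => _) = fun x => f x * f x ^+ n);
  [exact: ctsM|apply/funext => x; rewrite exprS].
Qed.

Lemma ctsZ (W : normedModType R) (a : R) (f : T -> W) :
  cts_fun f -> cts_fun (fun x => a *: f x).
Proof. by move=> cf x; apply: cvgZl_tmp; exact: cf. Qed.

Lemma cts_enorm2 (n : nat) (f : T -> 'rV[R]_n) :
  cts_fun f -> cts_fun (fun x => enorm (f x) ^+ 2).
Proof. exact: continuous_sqr_enorm. Qed.

Lemma cts_comp (U W : topologicalType) (g : U -> W) (f : T -> U) :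
  cts_fun g -> cts_fun f -> cts_fun (fun x => g (f x)).
Proof.
by move=> cg cf x; apply: (@continuous_comp _ _ _ f g); [exact: cf|exact: cg].
Qed.

Lemma cts_fst (U W : topologicalType) (f : T -> U * W) :
  cts_fun f -> cts_fun (fun x => (f x).1).
Proof. by apply: cts_comp => x; exact: cvg_fst. Qed.

Lemma cts_snd (U W : topologicalType) (f : T -> U * W) :
  cts_fun f -> cts_fun (fun x => (f x).2).
Proof. by apply: cts_comp => x; exact: cvg_snd. Qed.

Lemma cts_cst (U : topologicalType) (c : U) : cts_fun (fun _ : T => c).
Proof. by move=> x; exact: cvg_cst. Qed.

Lemma cts_id : cts_fun (fun x : T => x).
Proof. by move=> x. Qed.

End ContinuityRules.

Ltac cts := repeat (
  lazymatch goal with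
  | H : cts_fun ?g |- cts_fun ?g => exact: H
  | |- cts_fun (fun x => x) => exact: cts_id
  | |- cts_fun fst => exact: (cts_fst cts_id)
  | |- cts_fun snd => exact: (cts_snd cts_id)
  | |- cts_fun (fun x => enorm _ ^+ 2) => apply: cts_enorm2
  | |- cts_fun (fun x => _ + _) => apply: ctsD
  | |- cts_fun (fun x => - _) => apply: ctsN
  | |- cts_fun (fun x => _ * _) => apply: ctsM
  | |- cts_fun (fun x => _ ^+ _) => apply: ctsX
  | |- cts_fun (fun x => _ *: _) => apply: ctsZ
  | |- cts_fun (fun x => _.1) => apply: cts_fst
  | |- cts_fun (fun x => _.2) => apply: cts_snd
  | H : cts_fun ?g |- cts_fun (fun x => ?g _) => apply: (cts_comp H)
  | |- cts_fun (fun x => ?c) => exact: cts_cst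
  end).

Section Doubling.
Context {R : realType} {d : nat}.
Local Notation V := 'rV[R]_d.

Lemma pmulr_sqr_ge0 (a x : R) : 0 < a -> 0 <= a * x ^+ 2.
Proof. by move=> a0; rewrite pmulr_rge0 ?sqr_ge0. Qed.

Lemma enorm_le_sqr1 (x : V) : enorm x <= enorm x ^+ 2 + 1.
Proof. by have := enorm_ge0 x; have := sqr_ge0 (enorm x - 1); nra. Qed.

(** At a maximum of [v1 y - v2 z - |y - z - c|^2 / (2 tau) - al |y|^2] the quadratic
    terms are the jets of [v1] and [v2].  The term [al |y|^2] only makes the maximum
    exist: [al |y|^2] stays bounded there, so its gradient [a] is as small as wanted
    once [al] is.  The shift [c] compares [v1] with a translate of [v2]. *)
Lemma doubling (v1 v2 : V -> R) (M : R) (c : V) (tau e : R) (x0 y0 : V) :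
  continuous v1 -> continuous v2 ->
  (forall x, `|v1 x| <= M) -> (forall x, `|v2 x| <= M) -> 0 < tau -> 0 < e ->
  exists y z a, [/\ enorm a <= e,
    superjet v1 y (tau^-1 *: (y - z - c) + a),
    subjet v2 z (tau^-1 *: (y - z - c)) &
    v1 x0 - v2 y0 - (2 * tau)^-1 * enorm (x0 - y0 - c) ^+ 2 - e <=
    v1 y - v2 z - (2 * tau)^-1 * enorm (y - z - c) ^+ 2].
Proof.
move=> cv1 cv2 M1 M2 tau0 e0.
have M0 : 0 <= M by exact: le_trans (M1 0).
pose h := (2 * tau)^-1; have h0 : 0 < h by rewrite invr_gt0 mulr_gt0.
have tauE : tau^-1 = 2 * h by rewrite /h; field; rewrite gt_eqF.
rewrite -/h; clearbody h.
pose Q := 4 * M + h * enorm (x0 - y0 - c) ^+ 2 + e.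
have Q0 : 0 < Q.
  have h1 : 0 <= h * enorm (x0 - y0 - c) ^+ 2 by exact: pmulr_sqr_ge0.
  rewrite /Q; lra.
(* [al = e^2 / D] meets both [al |x0|^2 <= e] and [4 al Q <= e^2] *)
pose D := e * (enorm x0 ^+ 2 + 1) + 4 * Q.
have X0 := sqr_ge0 (enorm x0).
have D0 : 0 < D by rewrite /D addr_gt0 ?mulr_gt0//; lra.
pose al := e ^+ 2 / D.
have al0 : 0 < al by rewrite divr_gt0 ?exprn_gt0.
have alD : al * D = e ^+ 2 by rewrite /al mulfVK// gt_eqF.
have alx0 : al * enorm x0 ^+ 2 <= e.
  suff : e * (al * enorm x0 ^+ 2) <= e * e by rewrite ler_pM2l.
  move: alD; rewrite /D; nra.
have alQ : al * (4 * Q) <= e ^+ 2.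
  rewrite -alD /D ler_pM2l// lerDr mulr_ge0 ?ltW//; lra.
clear alD; clearbody al; clear D X0 D0.
(* [z] and the two times are dummy variables, forced to a bounded set *)
pose F (p : V * V * V * R * R) :=
  v1 p.1.1.1.1 - v2 p.1.1.1.2 - h * enorm (p.1.1.1.1 - p.1.1.1.2 - c) ^+ 2
  - al * enorm p.1.1.1.1 ^+ 2 - enorm p.1.1.2 ^+ 2 - p.1.2 ^+ 2 - p.2 ^+ 2.
have cF : cts_fun F.
  have c1 : cts_fun v1 by []; have c2 : cts_fun v2 by [].
  by rewrite /F; cts.
have Fbd x y z t s : F (x0, y0, 0, 0, 0) <= F (x, y, z, t, s) ->
   [/\ al * enorm x ^+ 2 <= Q, h * enorm (x - y - c) ^+ 2 <= Q,
       enorm z ^+ 2 <= Q, t ^+ 2 <= Q & s ^+ 2 <= Q].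
  rewrite /F /= enorm0 expr0n /= !subr0.
  have := M1 x; have := M2 y; have := M1 x0; have := M2 y0.
  rewrite !ler_norml => /andP[? ?] /andP[? ?] /andP[? ?] /andP[? ?].
  have h1 : 0 <= al * enorm x ^+ 2 by exact: pmulr_sqr_ge0.
  have h2 : 0 <= h * enorm (x - y - c) ^+ 2 by exact: pmulr_sqr_ge0.
  have h3 := sqr_ge0 (enorm z); have h4 := sqr_ge0 t; have h5 := sqr_ge0 s.
  by rewrite /Q; split; lra.
clearbody Q.
pose B := Q / al + Q / h + Q + enorm c + 2.
have coer x y z t s : 0 <= t -> 0 <= s -> F (x0, y0, 0, 0, 0) <= F (x, y, z, t, s) ->
    [/\ enorm x <= B, enorm y <= B, enorm z <= B, t <= B & s <= B].
  move=> t0 s0 /Fbd[h1 h2 h3 h4 h5].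
  have g1 : enorm x ^+ 2 <= Q / al by rewrite ler_pdivlMr// mulrC.
  have g2 : enorm (x - y - c) ^+ 2 <= Q / h by rewrite ler_pdivlMr// mulrC.
  have := enorm_le_sqr1 x; have := enorm_le_sqr1 (x - y - c).
  have := enorm_le_sqr1 z; have := enorm_ge0 c.
  have : enorm y <= enorm x + enorm (x - y - c) + enorm c.
    rewrite {1}(_ : y = x - (x - y - c) - c).
      by rewrite (le_trans (enormD _ _))// enormN lerD2r (le_trans (enormD _ _))// enormN.
    by row_ring.
  have := divr_ge0 (ltW Q0) (ltW al0); have := divr_ge0 (ltW Q0) (ltW h0).
  have := sqr_ge0 (t - 1); have := sqr_ge0 (s - 1).
  by rewrite /B => ? ? ? ? ? ? ? ?; split; try lra; nra.
have [y [z [w [t [s [t0 s0 Fmax]]]]]] := coercive_max cF (lexx 0) (lexx 0) coer.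
have := Fmax x0 y0 0 0 0 (lexx 0) (lexx 0) => Fge.
have [hy _ _ _ _] := Fbd _ _ _ _ _ Fge.
exists y, z, ((2 * al) *: y); split.
- rewrite -(@ler_pXn2r _ 2)// ?nnegrE ?enorm_ge0 ?(ltW e0)//.
  have h1 : al * (al * enorm y ^+ 2) <= al * Q by rewrite ler_pM2l.
  by rewrite enormZ exprMn real_normK ?num_real//; lra.
- exists (h + al) => x; have := Fmax x z w t s t0 s0; rewrite /F /=.
  have := sqr_enorm_shift x y (z + c); rewrite !opprD !addrA => ->.
  have := sqr_enorm_shift x y 0; rewrite !subr0 => ->.
  rewrite tauE !dotE; lra.
- exists h => x; have := Fmax y x w t s t0 s0; rewrite /F /=.
  have := sqr_enorm_shift x z (y - c).
  rewrite (enormB x (y - c)) (enormB z (y - c)) -!(addrAC y _ (- c)) => ->.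
  have -> : z - (y - c) = - (y - z - c) by row_ring.
  rewrite tauE !dotE; lra.
- have := Fge; rewrite /F /= enorm0 expr0n /= !subr0.
  have h1 : 0 <= al * enorm y ^+ 2 by exact: pmulr_sqr_ge0.
  have := sqr_ge0 (enorm w); have := sqr_ge0 t; have := sqr_ge0 s; lra.
Qed.

End Doubling.

(** * The Hamiltonian on bounded sets of momenta *)

Section Hamiltonian.
Context {R : realType} {d : nat}.
Local Notation V := 'rV[R]_d.
Variable H : V -> V -> R.
Hypothesis Ha : assumption_a H.

Lemma hamiltonian_lip (K : R) : exists2 M : R, 0 < M &
  (forall p y, enorm p <= K -> `|H p y| <= M) /\
  (forall p p' y, enorm p <= K -> enorm p' <= K ->
     `|H p y - H p' y| <= M * enorm (p - p')).
Proof.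
have K0 : 0 < `|K| + 1 by have := normr_ge0 K; lra.
have [_ [M HM]] := Ha K0; exists (`|M| + 1); first by have := normr_ge0 M; lra.
have lt p : enorm p <= K -> eball (`|K| + 1) p.
  by rewrite /eball /= => pK; have := ler_norm K; lra.
split=> [p y /lt pK|p p' y /lt pK /lt p'K].
- by have := (HM y).1 p pK => /= h; have := ler_norm M; lra.
- have := (HM y).2 p p' pK p'K => /= h; have := ler_norm M; have := enorm_ge0 (p - p').
  by nra.
Qed.

(** Shrinking the argument slightly brings it into the open ball; this is how the
    open balls of [rho] and [Lconst] meet the closed bounds on gradients. *)
Lemma le_closed_ball (f : V -> R) (M r N : R) : 0 < M -> 0 < r ->
  (forall q q', enorm q <= r -> enorm q' <= r -> f q - f q' <= M * enorm (q - q')) ->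
  (forall q, enorm q < r -> f q <= N) -> forall q, enorm q <= r -> f q <= N.
Proof.
move=> M0 r0 fM fN q qr; apply/ler_addgt0Pr => e e0.
pose t := e / (e + M * r).
have Mr := mulr_gt0 M0 r0.
have den : 0 < e + M * r by lra.
have t0 : 0 < t by rewrite divr_gt0.
have tE : t * (e + M * r) = e by rewrite /t mulfVK// gt_eqF.
have t1 : t < 1 by rewrite /t ltr_pdivrMr//; lra.
clearbody t; have q0 := enorm_ge0 q.
have E : enorm ((1 - t) *: q) = (1 - t) * enorm q.
  by rewrite enormZ ger0_norm//; lra.
have tq : enorm ((1 - t) *: q) < r by rewrite E; nra.
have := fN _ tq; have := fM q ((1 - t) *: q) qr (ltW tq).
have -> : q - (1 - t) *: q = t *: q by row_ring.
rewrite enormZ (gtr0_norm t0) => h1 h2.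
have h3 : M * (t * enorm q) <= e by nra.
lra.
Qed.

Lemma hamiltonian_unif (K e : R) : 0 < e -> exists2 r : R, 0 < r &
  forall p y y', enorm p <= K -> enorm (y - y') < r -> `|H p y - H p y'| < e.
Proof.
move=> e0; have K0 : 0 < `|K| + 1 by have := normr_ge0 K; lra.
have [HU _] := Ha K0; have [r r0 Hr] := HU e e0; exists r => // p y y' pK yr.
have pB : eball (`|K| + 1) p by rewrite /eball /=; have := ler_norm K; lra.
by apply: Hr; rewrite ?subrr ?enorm0.
Qed.

Hypothesis Hb : assumption_b H.

(** [S] is the supremum of [H] over the ball of radius [K]; coercivity bounds the
    set of momenta at which [H] comes down to [S], whose radius is [Lconst H K]. *)
Lemma Lconst_spec (K : R) : 0 < K -> exists S : R,
  (forall p y, enorm p <= K -> H p y <= S) /\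
  (forall q y, H q y <= S -> enorm q <= Lconst H K).
Proof.
move=> K0; have [M M0 [HM HL]] := hamiltonian_lip K.
set A := [set (H py.1 py.2)%:E | py in @eball R d K `*` setT].
have Ab : (ereal_sup A <= M%:E)%E.
  apply: ge_ereal_sup => _ [[p y] [/= pK _] <-]; rewrite lee_fin.
  by rewrite (le_trans (ler_norm _))// HM// ltW.
have A0 : (ereal_sup A >= (H 0 0)%:E)%E.
  by apply: ereal_sup_ubound; exists (0, 0) => //=; split => //; rewrite /eball /= enorm0.
have Afin : ereal_sup A \is a fin_num.
  rewrite fin_numElt (lt_le_trans _ A0) ?ltNyr//=.
  by rewrite (le_lt_trans Ab) ?ltry.
set S := fine (ereal_sup A).
have SE : S%:E = ereal_sup A by rewrite fineK.
have HS p y : enorm p < K -> H p y <= S.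
  by move=> pK; rewrite -lee_fin SE; apply: ereal_sup_ubound; exists (p, y).
exists S; split=> [p y pK|q y HqS].
  apply: (@le_closed_ball (H^~ y) M K S M0 K0 _ _ p pK) => [q q' qK q'K|q]; last exact: HS.
  exact: le_trans (ler_norm _) (HL _ _ _ qK q'K).
rewrite /Lconst; apply: ub_le_sup; last first.
  exists q => //=; rewrite -/A -SE; apply: le_trans (_ : (H q y)%:E <= _)%E.
    by apply: ereal_inf_lbound; exists y.
  by rewrite lee_fin.
have [r Hr] := Hb (S + 1); exists r => _ [q' /= qS <-]; rewrite leNgt; apply/negP.
move=> /Hr /le_trans /(_ qS); rewrite -/A -SE lee_fin; lra.
Qed.

Lemma Lconst_gt0 (K : R) : (0 < d)%N -> 0 < K -> 0 < Lconst H K.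
Proof.
move=> d0 K0; have [S [HS HL]] := Lconst_spec K0.
pose q : V := (K / 2) *: delta_mx ord0 (Ordinal d0).
have qE : enorm q = K / 2.
  rewrite enormZ gtr0_norm ?divr_gt0// /enorm (bigD1 (Ordinal d0))//= big1 ?addr0.
    by rewrite mxE !eqxx expr1n sqrtr1 mulr1.
  by move=> i; rewrite mxE eqxx /= => /negbTE ->; rewrite expr0n.
have := HL q 0 (HS q 0 _); rewrite qE; lra.
Qed.

(** * The approximate cell problem *)

(** All comparison arguments for the cell problem, in one statement: [m1] and [m2]
    allow for approximate sub- and supersolutions, [p1] and [p2] for two momenta, [c]
    for translates.  Doubling produces two jets with almost the same gradient; the
    one of [v1] is bounded, by [L1], hence both are, and on bounded sets of momenta
    [H] is uniformly continuous.  This is why the Hamiltonians need only be compared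
    at the momenta that [v1] can see. *)
Lemma cell_comparison (v1 v2 : V -> R) (M delta m1 m2 N L1 : R) (p1 p2 c : V) :
  0 < delta -> continuous v1 -> continuous v2 ->
  (forall x, `|v1 x| <= M) -> (forall x, `|v2 x| <= M) ->
  (forall y q, superjet v1 y q ->
     enorm (p1 + q) <= L1 /\ delta * v1 y + H (p1 + q) y <= m1) ->
  (forall z q, subjet v2 z q -> m2 <= delta * v2 z + H (p2 + q) z) ->
  (forall q z, enorm (p1 + q) <= L1 -> H (p2 + q) z <= H (p1 + q) (z + c) + N) ->
  forall x, delta * (v1 (x + c) - v2 x) <= m1 - m2 + N.
Proof.
move=> delta0 cv1 cv2 M1 M2 sub sup HN x; apply/ler_addgt0Pr => e e0.
have M0 : 0 <= M by exact: le_trans (M1 0).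
pose Kb := L1 + enorm p1 + enorm p2 + 1.
have [ML ML0 [_ HL]] := hamiltonian_lip Kb.
have e3 : 0 < e / 3 by lra.
have [r r0 Hr] := hamiltonian_unif Kb e3.
pose e' := Num.min 1 (Num.min (e / 3 / ML) (e / 3 / delta)).
have e'0 : 0 < e' by rewrite !lt_min ltr01 !divr_gt0.
have [e'1 e'M e'd] : [/\ e' <= 1, ML * e' <= e / 3 & delta * e' <= e / 3].
  split; first by rewrite ge_min lexx.
    by rewrite mulrC -ler_pdivlMr// !ge_min lexx orbT.
  by rewrite mulrC -ler_pdivlMr// !ge_min lexx !orbT.
(* small enough for [y] and [z + c] to be within the modulus [r] at the maximum *)
pose tau := r ^+ 2 / (2 * (4 * M + 2)).
have den : 0 < 2 * (4 * M + 2) by lra.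
have tau0 : 0 < tau by rewrite divr_gt0 ?exprn_gt0.
have [y [z [a [ae sj1 sj2 hv]]]] := doubling c (x + c) x cv1 cv2 M1 M2 tau0 e'0.
move: hv; rewrite (_ : x + c - x - c = 0); last by row_ring.
rewrite enorm0 expr0n /= mulr0 subr0 => hv.
set q := tau^-1 *: (y - z - c) in sj1 sj2.
have [Lq sub1] := sub _ _ sj1; have sup2 := sup _ _ sj2.
have HNz := HN _ z Lq.
have h0 : 0 < (2 * tau)^-1 by rewrite invr_gt0 mulr_gt0.
have yzr : enorm (y - (z + c)) < r.
  rewrite opprD addrA -(@ltr_pXn2r _ 2)// ?nnegrE ?enorm_ge0 ?(ltW r0)//.
  have : (2 * tau)^-1 * enorm (y - z - c) ^+ 2 < (2 * tau)^-1 * r ^+ 2.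
    have -> : (2 * tau)^-1 * r ^+ 2 = 4 * M + 2.
      by rewrite /tau; field; rewrite !gt_eqF//; lra.
    move: (M1 y) (M2 z) (M1 (x + c)) (M2 x); rewrite !ler_norml.
    move=> /andP[? ?] /andP[? ?] /andP[? ?] /andP[? ?]; lra.
  by rewrite ltr_pM2l.
have p1q : enorm (p1 + (q + a)) <= Kb.
  by have := enorm_ge0 p1; have := enorm_ge0 p2; rewrite /Kb; lra.
have p2qa : enorm (p2 + (q + a)) <= Kb - 1.
  rewrite (_ : p2 + (q + a) = (p1 + (q + a)) + p2 - p1); last by row_ring.
  have := enormD (p1 + (q + a) + p2) (- p1); have := enormD (p1 + (q + a)) p2.
  rewrite enormN /Kb; lra.
have dq : (p2 + q) - (p2 + (q + a)) = - a by row_ring.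
have p2q : enorm (p2 + q) <= Kb.
  have := enormD (p2 + q - (p2 + (q + a))) (p2 + (q + a)).
  rewrite subrK dq enormN; lra.
have p2qa' : enorm (p2 + (q + a)) <= Kb by apply: (le_trans p2qa); rewrite lerBlDr lerDl.
have h1 := HL (p2 + q) (p2 + (q + a)) z p2q p2qa'.
rewrite dq enormN in h1.
have h1' : `|H (p2 + q) z - H (p2 + (q + a)) z| <= e / 3.
  by apply: (le_trans h1); apply: le_trans e'M; rewrite ler_pM2l.
have h2 := Hr _ y (z + c) p1q yzr.
move: h1' h2; rewrite ler_norml ltr_norml => /andP[_ h3] /andP[h4 _].
have h5 : delta * (v1 (x + c) - v2 x) <= delta * (v1 y - v2 z) + e / 3.
  have : v1 (x + c) - v2 x <= v1 y - v2 z + e'.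
    have := pmulr_sqr_ge0 (enorm (y - z - c)) h0; lra.
  by rewrite -(ler_pM2l delta0) mulrDr => h; lra.
lra.
Qed.

End Hamiltonian.

Section CellProblem.
Context {R : realType} {d : nat}.
Local Notation V := 'rV[R]_d.
Variable H : V -> V -> R.
Hypothesis Ha : assumption_a H.
Variables (K SK L : R).
Hypothesis K0 : 0 < K.
Hypothesis HS : forall p y, enorm p <= K -> H p y <= SK.
Hypothesis SL : forall q y, H q y <= SK -> enorm q <= L.
Implicit Types (delta : R) (p : V) (v : V -> R).

Section OneSolution.
Variables (delta M : R) (p : V) (v : V -> R).
Hypotheses (delta0 : 0 < delta) (pK : enorm p <= K).
Hypotheses (cv : continuous v) (Mv : forall x, `|v x| <= M).
Hypothesis vsol : cell_solution H delta p v.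

(** Comparison with the subsolution [- S / delta], in the form of [v1 = 0]: its
    superjets vanish, so it only sees [H] at the momentum [p]. *)
Lemma cell_lower_bound x : - SK <= delta * v x.
Proof.
suff : delta * (0 - v x) <= SK - 0 + 0 by lra.
apply: (@cell_comparison _ _ _ Ha (fun=> 0) v M delta SK 0 0 K p p 0) => //.
- exact: cts_cst.
- by move=> _; rewrite normr0; exact: le_trans (Mv 0).
- move=> y q qj.
  have q0 : enorm q <= 0.
    by apply: (@superjet_lip _ _ (fun=> 0) y) => // z; rewrite mul0r subr0.
  have pqK : enorm (p + q) <= K by have := enormD p q; move: pK; lra.


  by split=> //; rewrite mulr0 add0r HS.
- by move=> z q /(cell_subjet vsol).
- by move=> q z _; rewrite !addr0.
Qed.

(** At a point where [v] is touched from above, [H (p + q) y <= - delta v <= S]. *)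
Lemma cell_gradient_bound y q : superjet v y q -> enorm (p + q) <= L.
Proof.
move=> /(cell_superjet vsol) h; apply: (SL (y := y)).
have := cell_lower_bound y; lra.
Qed.

(** An almost-period of [H] on momenta of length at most [L] is an almost-period of
    [delta * v]: by [cell_gradient_bound], no other momentum occurs in the comparison
    of [v] with its translate. *)
Lemma cell_translation (c : V) (N : R) :
  (forall q z, enorm q <= L -> H q z <= H q (z + c) + N) ->
  forall x, delta * (v (x + c) - v x) <= N.
Proof.
move=> HN x; suff : delta * (v (x + c) - v x) <= 0 - 0 + N by rewrite subr0 add0r.
apply: (@cell_comparison _ _ _ Ha v v M delta 0 0 N L p p c) => //.
- by move=> y q qj; split; [exact: cell_gradient_bound qj|exact: cell_superjet vsol qj].
- by move=> z q /(cell_subjet vsol).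
- by move=> q z; exact: HN.
Qed.

(** A gradient bound in the sense of jets gives a Lipschitz bound: doubling with
    parameter [tau = r / (2 G)] reduces an increment over distance [r] to one over
    distance [r / 2], and uniform continuity starts the induction. *)
Lemma cell_lipschitz : unif_continuous v ->
  forall x y, v x - v y <= 2 * (L + K + 1) * enorm (x - y).
Proof.
move=> /unif_continuousP uv x y; set G := L + K + 1.
have L0 : 0 <= L.
  exact: le_trans (enorm_ge0 _) (@SL p 0 (HS _ pK)).
have G0 : 0 < G by rewrite /G; move: K0; lra.
apply/ler_addgt0Pr => e e0.
have [r r0 vr] := uv e e0.
have small x' y' : enorm (x' - y') < r -> v x' - v y' <= e.
  move=> xyr; have := vr (x', y'); rewrite /= -!ball_normE /= => h.
  have /h : `|x' - y'| < r by exact: le_lt_trans (norm_le_enorm _) xyr.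
  by move=> /ltW; rewrite ler_norml => /andP[].
suff main n x' y' : enorm (x' - y') < 2 ^+ n * r ->
    v x' - v y' <= 2 * G * enorm (x' - y') + e.
  have [n nr] : exists n, enorm (x - y) / r < 2 ^+ n.
    have := archi_boundP (divr_ge0 (enorm_ge0 (x - y)) (ltW r0)).
    set n := Num.bound _ => hn; exists n; apply: (lt_trans hn).
    by rewrite -natrX ltr_nat ltn_expl.
  by apply: (main n); rewrite -ltr_pdivrMr.
elim: n x' y' => [|n IH] x' y' xyn.
  have := enorm_ge0 (x' - y'); have := small x' y'; rewrite expr0 mul1r in xyn.
  by move=> /(_ xyn); nra.
set s := enorm (x' - y') in xyn *.
have [s0|s0] := leP s 0.
  have := small x' y' (le_lt_trans s0 r0).
  have := enorm_ge0 (x' - y'); rewrite -/s; nra.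
apply/ler_addgt0Pr => e1 e10.
pose tau := s / (2 * G); have tau0 : 0 < tau by rewrite divr_gt0 ?mulr_gt0.
have tauE : tau * (2 * G) = s by rewrite /tau mulfVK// gt_eqF// mulr_gt0.
have [] := @doubling _ _ v v M 0 tau (Num.min 1 e1) x' y' cv cv Mv Mv tau0.
  by rewrite lt_min ltr01.
move=> a [b [w [we sj _]]]; rewrite !subr0 -/s in sj *.
move: we; rewrite le_min => /andP[w1 _] hab.
have := cell_gradient_bound sj; set g := tau^-1 *: (a - b) => gL.
have gG : enorm g <= G.
  rewrite (_ : g = (p + (g + w)) - p - w); last by row_ring.
  have := enormD (p + (g + w) - p) (- w); have := enormD (p + (g + w)) (- p).
  rewrite !enormN /G; move: pK; lra.
have abE : enorm (a - b) <= s / 2.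
  have -> : a - b = tau *: g by rewrite /g scalerA mulfV ?scale1r// gt_eqF.
  rewrite enormZ gtr0_norm// (_ : s / 2 = tau * G); last by rewrite -tauE; field.
  by rewrite ler_pM2l.
have step : v a - v b <= 2 * G * (s / 2) + e.
  apply: (le_trans (IH a b _)).
    apply: (le_lt_trans abE); rewrite ltr_pdivrMr//.
    by rewrite (lt_le_trans xyn)// exprS; lra.
  by rewrite lerD2r ler_pM2l// mulr_gt0.
have tau2 : (2 * tau)^-1 * s ^+ 2 = G * s.
  by rewrite /tau; field; rewrite !gt_eqF.
have sq0 : 0 <= (2 * tau)^-1 * enorm (a - b) ^+ 2.
  by apply: pmulr_sqr_ge0; rewrite invr_gt0 mulr_gt0.
have : Num.min 1 e1 <= e1 by rewrite ge_min lexx orbT.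
move: hab; rewrite tau2; lra.
Qed.

End OneSolution.

(** The momenta met in the comparison stay in the ball of radius [L + 2 K], on which
    [H] is Lipschitz. *)
Lemma cell_momentum : exists2 M : R, 0 < M & forall delta p1 p2 v1 v2 B1 B2,
  0 < delta -> enorm p1 <= K -> enorm p2 <= K ->
  continuous v1 -> (forall x, `|v1 x| <= B1) -> cell_solution H delta p1 v1 ->
  continuous v2 -> (forall x, `|v2 x| <= B2) -> cell_solution H delta p2 v2 ->
  forall x, delta * (v1 x - v2 x) <= M * enorm (p1 - p2).
Proof.
have [M M0 [_ HM]] := hamiltonian_lip Ha (L + 2 * K).
exists M => // delta p1 p2 v1 v2 B1 B2 delta0 p1K p2K c1 b1 s1 c2 b2 s2 x.
suff : delta * (v1 (x + 0) - v2 x) <= 0 - 0 + M * enorm (p1 - p2).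
  by rewrite addr0 subr0 add0r.
apply: (@cell_comparison _ _ _ Ha v1 v2 (Num.max B1 B2) delta 0 0 _ L p1 p2 0) => //.
- by move=> y; rewrite le_max b1.
- by move=> y; rewrite le_max b2 orbT.
- move=> y q qj; split; last exact: cell_superjet s1 qj.
  exact: cell_gradient_bound delta0 p1K c1 b1 s1 _ _ qj.
- by move=> z q /(cell_subjet s2).
- move=> q z qL; rewrite addr0.
  have q2 : enorm (p2 + q) <= L + 2 * K.
    rewrite (_ : p2 + q = (p1 + q) + p2 - p1); last by row_ring.
    have := enormD (p1 + q + p2) (- p1); have := enormD (p1 + q) p2.
    rewrite enormN; lra.
  have := HM (p2 + q) (p1 + q) z q2 (le_trans qL _).
  rewrite (_ : p2 + q - (p1 + q) = - (p1 - p2)); last by row_ring.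
  rewrite enormN ler_norml => h; have /h/andP[] : L <= L + 2 * K by move: K0; lra.
  lra.
Qed.

End CellProblem.

(** * Approximate correctors and the effective Hamiltonian *)

Section Effective.
Context {R : realType} {d : nat}.
Local Notation V := 'rV[R]_d.
Variable H : V -> V -> R.
Hypothesis Ha : assumption_a H.
Variables (K SK L : R).
Hypothesis K0 : 0 < K.
Hypothesis HS : forall p y, enorm p <= K -> H p y <= SK.
Hypothesis SL : forall q y, H q y <= SK -> enorm q <= L.
Variable v : R -> V -> V -> R.
Hypothesis v_sol : cell_family H v.
Variable Hbar : V -> R.
Hypothesis Hbar_eff : effective_hamiltonian v Hbar.
Implicit Types (delta : R) (p : V).

Lemma cell_family_spec delta p : 0 < delta -> exists M : R,
  [/\ forall y, `|v delta p y| <= M, continuous (v delta p),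
      unif_continuous (v delta p) & cell_solution H delta p (v delta p)].
Proof.
move=> delta0; have [[M vM] uc sol] := v_sol p delta0; exists M; split=> //.
by have [cv _ _] := sol => x; apply: cv; rewrite inE.
Qed.

Lemma effective_near p (e : R) : 0 < e ->
  \forall delta \near 0^'+, forall y, `|delta * v delta p y + Hbar p| <= e.
Proof.
move=> e0; have [_ /(_ p) lim] := Hbar_eff.
have lt0e : (0%E < e%:E :> \bar R)%E by rewrite lte_fin.
have near_e : \forall delta \near 0^'+,
    (ereal_sup [set (`|delta * v delta p y + Hbar p|)%:E | y in setT] < e%:E)%E.
  exact: lim _ (open_ereal_lt' lt0e).
apply: filterS near_e => delta /= de y.
rewrite -lee_fin (le_trans _ (ltW de))//.
by apply: ereal_sup_ubound; exists y.
Qed.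

Lemma effective_limit p (e b : R) : 0 < e -> 0 < b ->
  exists delta, [/\ 0 < delta, delta < b &
    forall y, `|delta * v delta p y + Hbar p| <= e].
Proof.
move=> e0 b0; have [delta [[de db] dgt]] := @filter_ex _ _ _ _
  (filterI (filterI (effective_near p e0) (nbhs_right_lt b0)) (nbhs_right_gt 0)).
by exists delta.
Qed.

(** If [m <= delta v], then [v] is, up to [dl M], a subsolution of the cell problem
    with a smaller discount [dl] and right-hand side [- m]; compare it with the
    solution for [dl] and let [dl] tend to 0. *)
Lemma effective_le delta p (m : R) : 0 < delta -> enorm p <= K ->
  (forall y, m <= delta * v delta p y) -> m <= - Hbar p.
Proof.
move=> delta0 pK mv; apply/ler_addgt0Pr => e e0.
have [M [vM cv _ vs]] := cell_family_spec p delta0.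
have M0 : 0 <= M by exact: le_trans (vM 0).
have b0 : 0 < e / 2 / (2 * M + 1) by rewrite !divr_gt0//; lra.
have e2 : 0 < e / 2 by lra.
have [dl [dl0 dlb dlH]] := effective_limit p e2 b0.
have [M' [vM' cv' _ vs']] := cell_family_spec p dl0.
have dlM : dl * (2 * M + 1) < e / 2 by rewrite -ltr_pdivlMr//; lra.
have h : dl * (v delta p (0 + 0) - v dl p 0) <= (- m + dl * M) - 0 + 0.
  apply: (@cell_comparison _ _ _ Ha _ _ (Num.max M M') dl _ 0 0 L p p 0) => //.
  - by move=> y; rewrite le_max vM.
  - by move=> y; rewrite le_max vM' orbT.
  - move=> y q qj; split.
      exact: (cell_gradient_bound Ha HS SL delta0 pK cv vM vs qj).
    have := cell_superjet vs qj; have := mv y.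
    have : dl * v delta p y <= dl * M.
      by rewrite ler_pM2l//; exact: le_trans (ler_norm _) (vM y).
    lra.
  - by move=> z q /(cell_subjet vs').
  - by move=> q z _; rewrite !addr0.
have := dlH 0; rewrite ler_norml => /andP[_ h2].
have h3 : - (dl * M) <= dl * v delta p (0 + 0).
  by rewrite -mulrN ler_pM2l//; have := vM (0 + 0); rewrite ler_norml => /andP[].
nra.
Qed.

(** The mirror image of [effective_le], with [v] as a supersolution. *)
Lemma effective_ge delta p (m : R) : 0 < delta -> enorm p <= K ->
  (forall y, delta * v delta p y <= m) -> - Hbar p <= m.
Proof.
move=> delta0 pK mv; apply/ler_addgt0Pr => e e0.
have [M [vM cv _ vs]] := cell_family_spec p delta0.
have M0 : 0 <= M by exact: le_trans (vM 0).
have b0 : 0 < e / 2 / (2 * M + 1) by rewrite !divr_gt0//; lra.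
have e2 : 0 < e / 2 by lra.
have [dl [dl0 dlb dlH]] := effective_limit p e2 b0.
have [M' [vM' cv' _ vs']] := cell_family_spec p dl0.
have dlM : dl * (2 * M + 1) < e / 2 by rewrite -ltr_pdivlMr//; lra.
have h : dl * (v dl p (0 + 0) - v delta p 0) <= 0 - (- m - dl * M) + 0.
  apply: (@cell_comparison _ _ _ Ha _ _ (Num.max M M') dl 0 _ 0 L p p 0) => //.
  - by move=> y; rewrite le_max vM' orbT.
  - by move=> y; rewrite le_max vM.
  - move=> y q qj; split; last exact: cell_superjet vs' qj.
    exact: (cell_gradient_bound Ha HS SL dl0 pK cv' vM' vs' qj).
  - move=> z q qj; have := cell_subjet vs qj; have := mv z.
    have : - (dl * M) <= dl * v delta p z.
      by rewrite -mulrN ler_pM2l//; have := vM z; rewrite ler_norml => /andP[].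
    lra.
  - by move=> q z _; rewrite !addr0.
have := dlH (0 + 0); rewrite ler_norml => /andP[h2 _].
have h3 : dl * v delta p 0 <= dl * M.
  by rewrite ler_pM2l//; exact: le_trans (ler_norm _) (vM 0).
nra.
Qed.

Lemma effective_lip : exists2 M : R, 0 < M & forall p1 p2,
  enorm p1 <= K -> enorm p2 <= K -> Hbar p2 - Hbar p1 <= M * enorm (p1 - p2).
Proof.
have [M M0 HM] := cell_momentum Ha K0 HS SL.
exists M => // p1 p2 p1K p2K; apply/ler_addgt0Pr => e e0.
have e2 : 0 < e / 2 by lra.
have [dl [[d1 d2] dl0]] := @filter_ex _ _ _ _
  (filterI (filterI (effective_near p1 e2) (effective_near p2 e2)) (nbhs_right_gt 0)).
have [B1 [b1 c1 _ s1]] := cell_family_spec p1 dl0.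
have [B2 [b2 c2 _ s2]] := cell_family_spec p2 dl0.
have := HM _ _ _ _ _ _ _ dl0 p1K p2K c1 b1 s1 c2 b2 s2 0.
have := d1 0; have := d2 0; rewrite !ler_norml => /andP[? ?] /andP[? ?]; lra.
Qed.

(** The error of the approximate corrector is controlled by the almost-periods:
    any point is an almost-period up to a shift of length at most [s / (L delta)],
    along which [delta * v] moves by at most a multiple of [s]. *)
Lemma corrector_error : 0 < L -> exists2 C : R, 0 < C &
  forall delta s p, 0 < delta -> 0 < s -> (rho H L (s / (L * delta)) <= s%:E)%E ->
    enorm p <= K ->
    (forall x y, delta * (v delta p x - v delta p y) <= C * s) /\
    (forall x, `|delta * v delta p x + Hbar p| <= C * s).
Proof.
move=> L0; pose G := L + K + 1.
have G0 : 0 < G by rewrite /G; move: K0; lra.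
have GL : 0 < G / L by rewrite divr_gt0.
exists (2 + 4 * (G / L)); first lra.
move=> delta s p delta0 s0 rhos pK; set C := 2 + _.
have [M [vM cv uv vs]] := cell_family_spec p delta0.
have lip := cell_lipschitz Ha K0 HS SL delta0 pK cv vM vs uv.
have [ML ML0 [_ HL]] := hamiltonian_lip Ha L.
set r := s / (L * delta) in rhos.
have near_period x e : 0 < e -> exists2 z, enorm z < r &
    forall q w, enorm q <= L -> `|H q (w + x) - H q (w + z)| <= s + e.
  move=> e0; have : (ereal_inf [set ereal_sup
      [set (`|H px.1 (px.2 + x) - H px.1 (px.2 + z)|)%:E
        | px in @eball R d L `*` setT] | z in @eball R d r] < (s + e)%:E)%E.
    apply: (@le_lt_trans _ _ s%:E); last by rewrite lte_fin; lra.
    by apply: le_trans rhos; apply: ereal_sup_ubound; exists x.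
  move=> /ereal_inf_lt[_ [z zr <-] /ltW hz]; exists z => // q w qL.
  apply: (@le_closed_ball _ _ (fun q => `|H q (w + x) - H q (w + z)|) (2 * ML) L _ _ L0) => //.
  - by rewrite mulr_gt0.
  - move=> q1 q2 q1L q2L.
    have := HL q1 q2 (w + x) q1L q2L; have := HL q1 q2 (w + z) q1L q2L.
    have := ler_normB (H q1 (w + x) - H q2 (w + x)) (H q1 (w + z) - H q2 (w + z)).
    have := lerB_dist (H q1 (w + x) - H q1 (w + z)) (H q2 (w + x) - H q2 (w + z)).
    rewrite (_ : _ - _ - (_ - _) = H q1 (w + x) - H q2 (w + x) - (H q1 (w + z) - H q2 (w + z))).
      by lra.
    by ring.
  - move=> q1 q1L; rewrite -lee_fin; apply: le_trans hz.
    by apply: ereal_sup_ubound; exists (q1, w).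
have shift x e : 0 < e -> exists2 z, enorm z < r &
    `|delta * (v delta p x - v delta p z)| <= s + e.
  move=> e0; have [z zr hz] := near_period x e e0; exists z => //.
  rewrite ler_norml; apply/andP; split.
    rewrite lerNl -mulrN opprB.
    have := @cell_translation _ _ _ Ha _ _ _ HS SL _ _ _ _ delta0 pK cv vM vs (z - x) (s + e) _ x.
    rewrite (_ : x + (z - x) = z); last by row_ring.
    apply=> q w qL; have := hz q (w - x) qL.
    rewrite (_ : w - x + x = w); last by row_ring.
    rewrite (_ : w - x + z = w + (z - x)); last by row_ring.
    by rewrite ler_norml => /andP[_]; lra.
  have := @cell_translation _ _ _ Ha _ _ _ HS SL _ _ _ _ delta0 pK cv vM vs (x - z) (s + e) _ z.
  rewrite (_ : z + (x - z) = x); last by row_ring.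
  apply=> q w qL; have := hz q (w - z) qL.
  rewrite (_ : w - z + z = w); last by row_ring.
  rewrite (_ : w - z + x = w + (x - z)); last by row_ring.
  by rewrite ler_norml => /andP[]; lra.
have osc x y : delta * (v delta p x - v delta p y) <= C * s.
  apply/ler_addgt0Pr => e e0; have e2 : 0 < e / 2 by lra.
  have [x' x'r hx] := shift x _ e2; have [y' y'r hy] := shift y _ e2.
  have h : delta * (v delta p x' - v delta p y') <= 4 * (G / L) * s.
    have rE : delta * r = s / L by rewrite /r; field; rewrite !gt_eqF.
    have xy : enorm (x' - y') <= 2 * r by have := enormD x' (- y'); rewrite enormN; lra.
    have := lip x' y'; rewrite -/G -(ler_pM2l delta0) => /le_trans; apply.
    rewrite (_ : 4 * (G / L) * s = 2 * G * (2 * (delta * r))); last first.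
      by rewrite rE; field; rewrite gt_eqF.
    have h1 : 2 * G * delta * enorm (x' - y') <= 2 * G * delta * (2 * r).
      by rewrite ler_pM2l// !mulr_gt0.
    lra.
  move: hx hy; rewrite !ler_norml /C => /andP[_ h1] /andP[h2 _]; lra.
split=> // x; rewrite ler_norml; apply/andP; split.
  suff : - Hbar p <= delta * v delta p x + C * s by lra.
  by apply: (@effective_ge delta p _ delta0 pK) => y; have := osc y x; lra.
suff : delta * v delta p x - C * s <= - Hbar p by lra.
by apply: (@effective_le delta p _ delta0 pK) => y; have := osc x y; lra.
Qed.

End Effective.

(** * Doubling of variables with a frozen corrector *)

Section PerturbedDoubling.
Context {R : realType} {d : nat}.
Local Notation V := 'rV[R]_d.

Definition lipschitz_t (K : R) (f : V -> R -> R) := forall x y s t,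
  0 <= s -> 0 <= t -> `|f x t - f y s| <= K * (enorm (x - y) + `|t - s|).

(** Reflecting time extends a function controlled on nonnegative times to a
    continuous function on all of space-time. *)
Lemma lipschitz_t_cts K f : lipschitz_t K f ->
  cts_fun (fun z : V * R => f z.1 `|z.2|).
Proof.
move=> fK z.
pose psi (z' : V * R) := K * (enorm (z'.1 - z.1) + `| `|z'.2| - `|z.2| |).
have cn : cts_fun (fun t : R => `|t|) by move=> t; exact: norm_continuous.
have ce : cts_fun (fun x : V => enorm x) by exact: (@continuous_enorm R d _ (fun x => x) cts_id).
have cpsi : cts_fun psi.
  rewrite /psi; apply: ctsM; first exact: cts_cst.
  apply: ctsD; first by apply: (cts_comp ce); cts.
  by apply: (cts_comp cn); apply: ctsD; [apply: (cts_comp cn)|]; cts.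
have psi0 : psi z = 0 by rewrite /psi !subrr enorm0 normr0 addr0 mulr0.
apply/cvgrPdist_le => e e0.
have /cvgrPdist_le/(_ e e0) := cpsi z; rewrite psi0.
apply: filterS => z'; rewrite sub0r normrN => h.
rewrite distrC; apply: le_trans (fK _ _ _ _ _ _) _ => //.
exact: le_trans (ler_norm _) h.
Qed.

Lemma lipschitz_t_cts_comp (T : topologicalType) K f (a : T -> V) (b : T -> R) :
  lipschitz_t K f -> cts_fun a -> cts_fun b -> cts_fun (fun p => f (a p) `|b p|).
Proof.
move=> fK ca cb.
have cab : cts_fun (fun p => (a p, b p)) by move=> p; exact: (cvg_pair (ca p) (cb p)).
exact: (cts_comp (lipschitz_t_cts fK) cab).
Qed.

Lemma le_of_sqr_le (a u Q : R) : 0 < a -> a * u ^+ 2 <= Q -> u <= Q / a + 1.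
Proof.
move=> a0; rewrite mulrC -ler_pdivlMr// => h.
by have := sqr_ge0 (u - 1); nra.
Qed.

Lemma young_sqr (K beta hb r : R) : 0 < hb -> hb * (2 * beta) = 1 ->
  K * r <= hb * r ^+ 2 + K ^+ 2 * beta / 2.
Proof.
move=> hb0 hbE.
have := pmulr_sqr_ge0 (r - K * beta) hb0.
have -> : hb * (r - K * beta) ^+ 2 =
  hb * r ^+ 2 - (hb * (2 * beta)) * (K * r) + (hb * (2 * beta)) * (K ^+ 2 * beta / 2).
  by field.
rewrite hbE; lra.
Qed.

Variables (f g : V -> R -> R) (K M : R).
Hypotheses (K_gt0 : 0 < K) (fK : lipschitz_t K f) (gK : lipschitz_t K g).
Hypotheses (fg0 : forall x, f x 0 = g x 0) (f0M : forall x, `|f x 0| <= M).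

(** The doubled functional without corrector.  The coefficients [kap] and [al] are
    taken small: the first makes all times [t >= 0] admissible, instead of a bounded
    interval with a terminal time, and the second gives compactness in space. *)
Definition penalized (hb gam kap al : R) (x y : V) (t s : R) :=
  f x t - g y s - hb * enorm (x - y) ^+ 2 - hb * (t - s) ^+ 2
  - gam * t - kap * t ^+ 2 - al * enorm x ^+ 2.

Section Penalized.
Variables (beta hb gam kap al : R).
Hypotheses (hb0 : 0 < hb) (hbE : hb * (2 * beta) = 1) (gam0 : 0 <= gam).
Hypotheses (kap0 : 0 < kap) (al0 : 0 < al).
Local Notation Phi := (penalized hb gam kap al).

Let Q0 := 2 * M + 2 * K ^+ 2 / kap + K ^+ 2 * beta.

(** [f] and [g] grow at most linearly, so each linear term is absorbed in half of the
    corresponding quadratic penalty. *)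
Lemma penalized_growth x y t s : 0 <= t -> 0 <= s ->
  al * enorm x ^+ 2 + kap / 2 * t ^+ 2 + hb / 2 * (t - s) ^+ 2
  + hb * enorm (x - y) ^+ 2 <= Q0 - Phi x y t s.
Proof.
move=> t0 s0; rewrite /penalized.
have := fK x x (lexx 0) t0; rewrite subrr enorm0 add0r subr0 (ger0_norm t0).
have := gK y y (lexx 0) s0; rewrite subrr enorm0 add0r subr0 (ger0_norm s0).
have := f0M x; have := f0M y; rewrite (fg0 y) !ler_norml.
move=> /andP[? ?] /andP[? ?] /andP[? ?] /andP[? ?].
have h1 : K * s <= K * t + K * `|t - s|.
  rewrite -mulrDr ler_pM2l//; have := ler_norm (s - t); rewrite distrC; lra.
have h2 : K * `|t - s| <= hb / 2 * (t - s) ^+ 2 + K ^+ 2 * beta.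
  have hb2 : 0 < hb / 2 by rewrite divr_gt0.
  have := @young_sqr K (2 * beta) (hb / 2) `|t - s| hb2.
  rewrite (_ : hb / 2 * (2 * (2 * beta)) = hb * (2 * beta)); last by field.
  move=> /(_ hbE); rewrite real_normK ?num_real//.
  by rewrite (_ : K ^+ 2 * (2 * beta) / 2 = K ^+ 2 * beta)//; field.
have h3 : 2 * K * t <= kap / 2 * t ^+ 2 + 2 * K ^+ 2 / kap.
  have kap2 : 0 < kap / 2 by rewrite divr_gt0.
  have := @young_sqr (2 * K) (kap^-1) (kap / 2) t kap2.
  rewrite (_ : kap / 2 * (2 * kap^-1) = 1); last by field; rewrite gt_eqF.
  move=> /(_ erefl).
  by rewrite (_ : (2 * K) ^+ 2 / kap / 2 = 2 * K ^+ 2 / kap)//; field; rewrite gt_eqF.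
have h4 := mulr_ge0 gam0 t0.
rewrite /Q0; lra.
Qed.

(** The extra term [W] may be any continuous function that confines [z] near a
    multiple of [x]; it is trivial at the first maximization and carries the
    corrector at the second one. *)
Lemma penalized_max (W : V * V * V -> R) (c nu B : R) :
  cts_fun W -> 0 < c -> 0 <= nu ->
  (forall x y z, c * enorm (z - nu *: x) ^+ 2 - B <= W (x, y, z)) ->
  exists (x y z : V) (t s : R), [/\ 0 <= t, 0 <= s & forall x' y' z' t' s', 0 <= t' -> 0 <= s' ->
    Phi x' y' t' s' - W (x', y', z') <= Phi x y t s - W (x, y, z)].
Proof.
move=> cW c0 nu0 WB.
pose F (p : V * V * V * R * R) :=
  Phi p.1.1.1.1 p.1.1.1.2 `|p.1.2| `|p.2| - W p.1.1.
have cn : cts_fun (fun t : R => `|t|) by move=> t; exact: norm_continuous.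
have cF : cts_fun F.
  rewrite /F /penalized; cts.
  all: try by apply: (cts_comp cn); cts.
  - by apply: (lipschitz_t_cts_comp fK); cts.
  - by apply: (lipschitz_t_cts_comp gK); cts.
pose Q := Q0 - F (0, 0, 0, 0, 0) + B.
pose X := Q / al + 1; pose T := Q / (kap / 2) + 1.
have kap2 : 0 < kap / 2 by rewrite divr_gt0.
have hb2 : 0 < hb / 2 by rewrite divr_gt0.
pose Y := Q / hb + 1; pose Z := Q / c + 1; pose D := Q / (hb / 2) + 1.
have [||x y z t s t0 s0 Fge|x [y [z [t [s [t0 s0 Fmax]]]]]] :=
    @coercive_max R d F 0 0 0 0 0 (X + Y + Z + nu * X + T + D) cF.
- exact: lexx.
- exact: lexx.
- have := penalized_growth x y t0 s0.
  have Wx := WB x y z.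
  move: Fge; rewrite {2}/F /= !ger0_norm// => Fge.
  have h1 := pmulr_sqr_ge0 (enorm x) al0.
  have h2 := pmulr_sqr_ge0 t kap2.
  have h3 := pmulr_sqr_ge0 (t - s) hb2.
  have h4 := pmulr_sqr_ge0 (enorm (x - y)) hb0.
  have h5 := pmulr_sqr_ge0 (enorm (z - nu *: x)) c0.
  move=> hQ.
  have xX : enorm x <= X by apply: le_of_sqr_le => //; rewrite /Q; lra.
  have tT : t <= T by apply: le_of_sqr_le => //; rewrite /Q; lra.
  have yY : enorm (x - y) <= Y by apply: le_of_sqr_le => //; rewrite /Q; lra.
  have zZ : enorm (z - nu *: x) <= Z by apply: le_of_sqr_le => //; rewrite /Q; lra.
  have sD : s - t <= D.
    by apply: le_of_sqr_le => //; rewrite -(sqrrN (s - t)) opprB /Q; lra.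
  have nX : enorm (nu *: x) <= nu * X.
    by rewrite enormZ ger0_norm//; exact: ler_wpM2l.
  have yx : enorm y <= enorm x + enorm (x - y).
    rewrite {1}(_ : y = x - (x - y)); last by row_ring.
    by rewrite (le_trans (enormD _ _))// enormN.
  have zx : enorm z <= enorm (z - nu *: x) + enorm (nu *: x).
    by rewrite {1}(_ : z = z - nu *: x + nu *: x) ?enormD//; row_ring.
  have := enorm_ge0 x; have := enorm_ge0 (x - y); have := enorm_ge0 (z - nu *: x).
  have := enorm_ge0 (nu *: x).
  have Qge0 : 0 <= Q by rewrite /Q; lra.
  have D0 : 0 <= D by rewrite /D addr_ge0 ?divr_ge0// ltW.
  clear -D0 xX tT yY zZ sD nX yx zx t0 s0.
  move=> *; split; lra.
exists x, y, z, t, s; split=> // x' y' z' t' s' t'0 s'0.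
by have := Fmax x' y' z' t' s' t'0 s'0; rewrite /F /= !ger0_norm.
Qed.

End Penalized.

(** At a maximum with a larger value both times are positive: at time 0 the two
    functions coincide, and [K r - r^2 / (2 beta) <= K^2 beta / 2]. *)
Lemma penalized_initial (beta hb gam kap al : R) x y t s :
  0 < hb -> hb * (2 * beta) = 1 -> 0 <= gam -> 0 < kap -> 0 < al ->
  0 <= t -> 0 <= s -> t = 0 \/ s = 0 ->
  penalized hb gam kap al x y t s <= K ^+ 2 * beta.
Proof.
move=> hb0 hbE gam0 kap0 al0 t0 s0 ts0.
have h : f x t - g y s <= K * enorm (x - y) + K * `|t - s|.
  rewrite -mulrDr; case: ts0 => ->.
    by rewrite fg0; apply: le_trans (ler_norm _) (gK _ _ _ _).
  by rewrite -fg0; apply: le_trans (ler_norm _) (fK _ _ _ _).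
have := young_sqr K (enorm (x - y)) hb0 hbE.
have := young_sqr K `|t - s| hb0 hbE; rewrite real_normK ?num_real//.
have := mulr_ge0 gam0 t0; have := pmulr_sqr_ge0 t kap0.
have := pmulr_sqr_ge0 (enorm x) al0; rewrite /penalized; lra.
Qed.

(** Doubling of variables with a corrector whose momentum [p] is chosen by a first
    maximization and then frozen.  The first maximum gives [|p| <= K] because [g] is
    [K]-Lipschitz.  The term [|x - y - beta p|^2 / (2 beta)] of the second functional
    vanishes at the first maximum, so at the second one it is at most the
    oscillation [eps N] of the corrector term; its gradient is half of the error
    [c2], which is thus of order [sqrt (eps N / beta)]. *)
Lemma perturbed_doubling (w : V -> V -> R) (N eps beta gam e t0 : R) (x0 : V) :
  0 < eps -> 0 < beta -> 0 <= gam -> 0 < e -> 0 <= t0 ->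
  (forall p, enorm p <= K -> continuous (w p)) ->
  (forall p x y, enorm p <= K -> w p x - w p y <= N) ->
  gam * t0 + K ^+ 2 * beta + eps * N < f x0 t0 - g x0 t0 ->
  exists (p x y z q c1 c2 : V) (t s a b : R),
  [/\ enorm p <= K, 0 < t, 0 < s & gam <= a - b] /\
  [/\ superjet_t f x t (p + q + c1) a, subjet_t g y s (p + c2) b &
      subjet (w p) z q] /\
  [/\ enorm (eps^-1 *: x - z) <= e, beta * enorm c2 ^+ 2 <= 8 * (eps * N) &
      enorm (c1 - c2) <= e].
Proof.
move=> eps0 beta0 gam0 e0 t00 cw wN gap.
have N0 : 0 <= N by have := wN 0 0 0; rewrite subrr enorm0; apply; exact: ltW.
have M0 : 0 <= M by exact: le_trans (f0M 0).
pose gapD := f x0 t0 - g x0 t0 - (gam * t0 + K ^+ 2 * beta + eps * N).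
have gapD0 : 0 < gapD by rewrite /gapD; lra.
pose hb := (2 * beta)^-1.
have hb0 : 0 < hb by rewrite invr_gt0 mulr_gt0.
have hbE : hb * (2 * beta) = 1 by rewrite /hb; field; rewrite gt_eqF.
pose kap := gapD / (4 * (t0 ^+ 2 + 1)).
have t021 : 0 < t0 ^+ 2 + 1 by have := sqr_ge0 t0; lra.
have kap0 : 0 < kap by rewrite divr_gt0 ?mulr_gt0.
have kapE : kap * t0 ^+ 2 <= gapD / 4.
  have : kap * (t0 ^+ 2 + 1) = gapD / 4 by rewrite /kap; field; rewrite gt_eqF.
  lra.
pose Q0 := 2 * M + 2 * K ^+ 2 / kap + K ^+ 2 * beta.
have K2 : 0 < K ^+ 2 by rewrite exprn_gt0.
have Q00 : 0 < Q0.
  have h1 : 0 <= 2 * K ^+ 2 / kap by apply: divr_ge0; [lra|exact: ltW].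
  have h2 : 0 < K ^+ 2 * beta by rewrite mulr_gt0.
  rewrite /Q0; lra.
pose al := Num.min (e ^+ 2 / (4 * Q0)) (gapD / (4 * (enorm x0 ^+ 2 + 1))).
have x021 : 0 < enorm x0 ^+ 2 + 1 by have := sqr_ge0 (enorm x0); lra.
have al0 : 0 < al by rewrite lt_min !divr_gt0 ?mulr_gt0 ?exprn_gt0.
have alQ : al * (4 * Q0) <= e ^+ 2.
  by rewrite -ler_pdivlMr ?mulr_gt0// ge_min lexx.
have alx0 : al * enorm x0 ^+ 2 <= gapD / 4.
  have : al <= gapD / (4 * (enorm x0 ^+ 2 + 1)) by rewrite ge_min lexx orbT.
  rewrite ler_pdivlMr ?mulr_gt0//; lra.
have growth x y t s := @penalized_growth beta hb gam kap al hb0 hbE gam0 kap0 x y t s.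
pose Phi := penalized hb gam kap al.
have base : K ^+ 2 * beta + eps * N < Phi x0 x0 t0 t0.
  rewrite /Phi /penalized !subrr enorm0 expr0n /= !mulr0 !subr0.
  move: kapE alx0 gapD0; rewrite /gapD; lra.
(* the unperturbed maximum, which selects the momentum [p] *)
have [|x y z|xh [yh [zh [th [sh [th0 sh0 max0]]]]]] :=
  @penalized_max beta hb gam kap al hb0 hbE gam0 kap0 al0
    (fun p => enorm p.2 ^+ 2) 1 0 0 _ ltr01 (lexx 0).
- by cts.
- by rewrite scale0r !subr0 mul1r.
have {}max0 x y t s : 0 <= t -> 0 <= s -> Phi x y t s <= Phi xh yh th sh.
  move=> h1 h2; have /= := max0 x y zh t s h1 h2; rewrite -/Phi; lra.
pose p := (2 * hb) *: (xh - yh).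
have bp : beta *: p = xh - yh.
  by rewrite /p scalerA (_ : beta * (2 * hb) = 1) ?scale1r//; move: hbE; lra.
have pK : enorm p <= K.
  rewrite -enormN; apply: (@superjet_lip _ _ (fun y => - g y sh) yh) (ltW K_gt0) _ _.
    move=> y; have := gK yh y sh0 sh0; rewrite subrr normr0 addr0 enormB.
    by rewrite ler_norml => /andP[? ?]; lra.
  exists hb => y; have := max0 xh y th sh th0 sh0; rewrite /Phi /penalized.
  rewrite (enormB xh y) (enormB xh yh) (sqr_enorm_shift y yh xh).
  rewrite (_ : - p = (2 * hb) *: (yh - xh)); last by rewrite /p; row_ring.
  rewrite dotZl; lra.
clearbody p.
have cwp : cts_fun (w p) := cw p pK.
pose h4 := N / (eps * e ^+ 2) + 1.
have e20 : 0 < e ^+ 2 by rewrite exprn_gt0.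
have h40 : 0 < h4.
  by apply: ltr_wpDl => //; apply: divr_ge0 => //; rewrite ltW ?mulr_gt0.
have h4E : eps * N <= h4 * (eps * e) ^+ 2.
  rewrite (_ : h4 * (eps * e) ^+ 2 = eps * N + (eps * e) ^+ 2).
    by rewrite lerDl sqr_ge0.
  by rewrite /h4; field; rewrite !gt_eqF.
(* the second maximum, with the corrector; it is compared with the first one at
   [z = xh / eps], where all penalties of [W] vanish *)
pose W (u : V * V * V) := eps * w p u.2 + h4 * enorm (u.1.1 - eps *: u.2) ^+ 2
  + hb * enorm (u.1.1 - u.1.2 - beta *: p) ^+ 2.
have cW : cts_fun W by rewrite /W; cts.
have [||x y z|x [y [z [t [s [t_ge0 s_ge0 max1]]]]]] :=
  @penalized_max beta hb gam kap al hb0 hbE gam0 kap0 al0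
    W (h4 * eps ^+ 2) eps^-1 (eps * (N - w p 0)) cW _ _ _.
- by rewrite mulr_gt0 ?exprn_gt0.
- by rewrite invr_ge0 ltW.
- have E : enorm (x - eps *: z) ^+ 2 = eps ^+ 2 * enorm (z - eps^-1 *: x) ^+ 2.
    rewrite (_ : x - eps *: z = - (eps *: (z - eps^-1 *: x))).
      by rewrite enormN enormZ exprMn real_normK ?num_real.
    by rewrite scalerBr scalerA mulfV ?gt_eqF// scale1r opprB.
  rewrite /W /= E.
  have : eps * (w p 0 - w p z) <= eps * N by rewrite ler_pM2l//; exact: wN.
  have := pmulr_sqr_ge0 (enorm (x - y - beta *: p)) hb0; lra.
have key : h4 * enorm (x - eps *: z) ^+ 2 + hb * enorm (x - y - beta *: p) ^+ 2
    <= eps * N /\ K ^+ 2 * beta < Phi x y t s.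
  have := max1 xh yh (eps^-1 *: xh) th sh th0 sh0.
  rewrite /W /= scalerA mulfV ?gt_eqF// scale1r subrr bp subrr enorm0 expr0n /=.
  rewrite -/Phi -bp.
  have := max0 x y t s t_ge0 s_ge0; have := max0 x0 x0 t0 t0 t00 t00.
  have : eps * (w p (eps^-1 *: xh) - w p z) <= eps * N.
    by rewrite ler_pM2l//; exact: wN.
  have := pmulr_sqr_ge0 (enorm (x - y - beta *: p)) hb0.
  have := pmulr_sqr_ge0 (enorm (x - eps *: z)) h40.
  by move=> *; split; lra.
have [pen Phi_gt] := key.
have notinit : ~ (t = 0 \/ s = 0).
  move=> ts; have := penalized_initial x y hb0 hbE gam0 kap0 al0 t_ge0 s_ge0 ts.
  by rewrite leNgt Phi_gt.
have t_gt0 : 0 < t.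
  by rewrite lt_neqAle t_ge0 andbT; apply/eqP => t1; apply: notinit; left.
have s_gt0 : 0 < s.
  by rewrite lt_neqAle s_ge0 andbT; apply/eqP => t1; apply: notinit; right.
pose wd := x - y - beta *: p.
have wdE : x - y - beta *: p = wd by [].
rewrite wdE in pen.
(* the gradient [(x - y) / beta] of the doubling term is [p + wd / beta] *)
have pE : p = (2 * hb) *: (x - y) - (2 * hb) *: wd.
  rewrite -scalerBr (_ : x - y - wd = beta *: p); last by rewrite /wd; row_ring.
  by rewrite scalerA (_ : 2 * hb * beta = 1) ?scale1r//; move: hbE; lra.
clearbody wd h4 al kap hb.
exists p, x, y, z, ((2 * h4) *: (x - eps *: z)), ((4 * hb) *: wd + (2 * al) *: x),
  ((4 * hb) *: wd), t, s, (2 * hb * (t - s) + gam + 2 * kap * t), (2 * hb * (t - s)).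
split; [split=> //|split; [split|split]].
- have := mulr_ge0 (ltW kap0) t_ge0; lra.
- exists (2 * hb + al + h4 + kap) => x' t' t'0.
  have := max1 x' y z t' s t'0 s_ge0; rewrite /penalized /W /=.
  have := sqr_enorm_shift x' x y; have := sqr_enorm_shift x' x (eps *: z).
  have := sqr_enorm_shift x' x 0; have := sqr_enorm_shift x' x (y + beta *: p).
  rewrite !subr0 !opprD !addrA wdE => -> -> -> ->.
  have dp : dot p (x' - x) = dot ((2 * hb) *: (x - y) - (2 * hb) *: wd) (x' - x) by rewrite -pE.
  rewrite !dotE in dp *.
  have X0 := sqr_ge0 (enorm (x' - x)); have T0 := sqr_ge0 (t' - t).
  have := mulr_ge0 (ltW kap0) X0; have := mulr_ge0 (ltW hb0) T0.
  have := mulr_ge0 (ltW al0) T0; have := mulr_ge0 (ltW h40) T0.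
  lra.
- exists (2 * hb) => y' s' s'0.
  have := max1 x y' z t s' t_ge0 s'0; rewrite /penalized /W /=.
  have := sqr_enorm_shiftN y' y x; have := sqr_enorm_shiftN y' y (x - beta *: p).
  rewrite -!(addrAC x _ (- (beta *: p))) wdE => -> ->.
  have dp : dot p (y' - y) = dot ((2 * hb) *: (x - y) - (2 * hb) *: wd) (y' - y) by rewrite -pE.
  rewrite !dotE in dp *.
  have T0 := sqr_ge0 (s' - s); have := mulr_ge0 (ltW hb0) T0.
  lra.
- exists (h4 * eps) => z'; rewrite -(ler_pM2l eps0).
  have := max1 x y z' t s t_ge0 s_ge0; rewrite /W /=.
  have := sqr_enorm_shiftN (eps *: z') (eps *: z) x.
  rewrite -scalerBr dotZr enormZ exprMn real_normK ?num_real// => ->.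
  rewrite dotNl dotZl; lra.
- have h : enorm (x - eps *: z) <= eps * e.
    rewrite -(@ler_pXn2r _ 2)// ?nnegrE ?enorm_ge0 ?mulr_ge0 ?(ltW e0) ?(ltW eps0)//.
    rewrite -(ler_pM2l h40); have := pmulr_sqr_ge0 (enorm wd) hb0; lra.
  rewrite -(ler_pM2l eps0); apply: le_trans h; rewrite -{1}(gtr0_norm eps0) -enormZ.
  by rewrite scalerBr scalerA mulfV ?gt_eqF// scale1r.
- rewrite enormZ exprMn real_normK ?num_real//.
  have -> : beta * ((4 * hb) ^+ 2 * enorm wd ^+ 2)
      = 8 * (hb * (2 * beta)) * (hb * enorm wd ^+ 2) by ring.
  rewrite hbE; have := pmulr_sqr_ge0 (enorm (x - eps *: z)) h40; lra.
- rewrite addrC addKr -(@ler_pXn2r _ 2)// ?nnegrE ?enorm_ge0 ?(ltW e0)//.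
  rewrite enormZ exprMn real_normK ?num_real//.
  have hx : al * enorm x ^+ 2 <= Q0.
    have := growth x y t s t_ge0 s_ge0; rewrite -/Phi -/Q0.
    have := mulr_gt0 K2 beta0; have kap2 : 0 < kap / 2 by rewrite divr_gt0.
    have hb2 : 0 < hb / 2 by rewrite divr_gt0.
    have := pmulr_sqr_ge0 t kap2; have := pmulr_sqr_ge0 (t - s) hb2.
    have := pmulr_sqr_ge0 (enorm (x - y)) hb0; lra.
  have : al * (al * enorm x ^+ 2) <= al * Q0 by rewrite ler_pM2l.
  lra.
Qed.

End PerturbedDoubling.

(** * One-sided rate *)

Section OneSidedRate.
Context {R : realType} {d : nat}.
Local Notation V := 'rV[R]_d.

Lemma superjet_t_lip (K : R) f (x : V) t q a : 0 <= K -> lipschitz_t K f ->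
  0 <= t -> superjet_t f x t q a -> enorm q <= K.
Proof.
move=> K0 fK t0 [B fB]; apply: (@superjet_lip _ _ (f^~ t) x) K0 _ _.
  move=> y; have := fK x y t t t0 t0; rewrite subrr normr0 addr0 enormB.
  by rewrite ler_norml => /andP[? ?]; lra.
exists B => y; have := fB y t t0.
by rewrite subrr expr0n /= mulr0 !addr0.
Qed.

Lemma lipschitz_tN (K : R) f : lipschitz_t K f ->
  lipschitz_t K (fun (x : V) t => - f x t).
Proof. by move=> fK x y s t s0 t0; rewrite -opprD normrN; exact: fK. Qed.

(** If the gap exceeded the bound, [perturbed_doubling] would apply with [gam] a
    large multiple of [theta + s].  The corrector hypothesis on [w] turns the
    equation for [f] at [x] into [a + Gbar p <= C' (theta + s)], to be compared with
    [0 <= b + Gbar (p + c2)], whereas [gam <= a - b].  The choice [theta^3 = eps]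
    balances [theta] against [eps / theta^2] inside the square root bounding [c2]. *)
Lemma one_sided_rate (f g : V -> R -> R) (w G : V -> V -> R) (Gbar : V -> R)
    (K M C ML MB theta s : R) :
  0 < K -> lipschitz_t K f -> lipschitz_t K g ->
  (forall x, f x 0 = g x 0) -> (forall x, `|f x 0| <= M) ->
  0 < C -> 0 < ML -> 0 < MB -> 0 < theta -> theta <= 1 -> 0 < s ->
  (forall x t q a, 0 < t -> superjet_t f x t q a ->
     a + G q ((theta ^+ 3)^-1 *: x) <= 0) ->
  (forall y t q b, 0 < t -> subjet_t g y t q b -> 0 <= b + Gbar q) ->
  (forall p, enorm p <= K -> continuous (w p)) ->
  (forall p x y, enorm p <= K -> theta * (w p x - w p y) <= C * s) ->
  (forall p z q, enorm p <= K -> subjet (w p) z q -> Gbar p - C * s <= G (p + q) z) ->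
  (forall p p' y, enorm p <= 3 * K + 1 -> enorm p' <= 3 * K + 1 ->
     `|G p y - G p' y| <= ML * enorm (p - p')) ->
  (forall e, 0 < e -> exists2 r, 0 < r & forall p y y', enorm p <= 3 * K + 1 ->
     enorm (y - y') < r -> `|G p y - G p y'| < e) ->
  (forall p1 p2, enorm p1 <= K -> enorm p2 <= K ->
     Gbar p2 - Gbar p1 <= MB * enorm (p1 - p2)) ->
  forall x0 t0, 0 <= t0 -> f x0 t0 - g x0 t0 <=
    (((MB + ML) * (2 * C + 1) + C + ML + 2) * t0 + (K ^+ 2 + C)) * (theta + s).
Proof.
move=> K0 fK gK fg0 f0M C0 ML0 MB0 th0 th1 s0 fsub gsup cw wosc wcor GL GU GbL x0 t0 t00.
set C3 := (MB + ML) * (2 * C + 1) + C + ML + 2.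
have E0 : 0 < theta + s by lra.
have MM : 0 < (MB + ML) * (2 * C + 1) by rewrite mulr_gt0//; lra.
have C30 : 0 < C3 by rewrite /C3; lra.
rewrite leNgt; apply/negP => gap.
pose N := C * s / theta.
have NE : theta * N = C * s by rewrite /N mulrC mulfVK// gt_eqF.
have th30 : 0 < theta ^+ 3 by rewrite exprn_gt0.
have epsN : theta ^+ 3 * N = theta ^+ 2 * (C * s) by rewrite -NE; ring.
have Cs0 : 0 < C * s by rewrite mulr_gt0.
have th2 : theta ^+ 2 <= 1 by rewrite exprn_ile1// ltW.
have epsN1 : theta ^+ 3 * N <= C * s by rewrite epsN ger_pMl.
have wN p x y : enorm p <= K -> w p x - w p y <= N.
  by move=> pK; rewrite -(ler_pM2l th0) NE; exact: wosc.
have [r r0 Gr] := GU (theta + s) E0.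
pose e := Num.min 1 (Num.min (theta + s) (r / 2)).
have r20 : 0 < r / 2 by rewrite divr_gt0.
have e0 : 0 < e by rewrite !lt_min ltr01 E0 r20.
have [e1 eE er] : [/\ e <= 1, e <= theta + s & e <= r / 2].
  by split; rewrite /e !ge_min lexx ?orbT.
clearbody e; clearbody N.
have gam0 : 0 <= C3 * (theta + s) by rewrite mulr_ge0// ltW.
have gap' : C3 * (theta + s) * t0 + K ^+ 2 * theta + theta ^+ 3 * N < f x0 t0 - g x0 t0.
  apply: le_lt_trans gap; have := sqr_ge0 K.
  have h1 : 0 <= K ^+ 2 * s by rewrite mulr_ge0 ?sqr_ge0// ltW.
  have h2 : 0 <= C * theta by rewrite mulr_ge0// ltW.
  lra.
have [p [x [y [z [q [c1 [c2 [t [t' [a [b]]]]]]]]]]] :=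
  perturbed_doubling K0 fK gK fg0 f0M th30 th0 gam0 e0 t00 cw wN gap'.
move=> [[pK tp tp' ab] [[fj gj wj] [xz c2N c12]]].
have K0' := ltW K0.
have fqK := superjet_t_lip K0' fK (ltW tp) fj.
have gqK := superjet_t_lip K0' (lipschitz_tN gK) (ltW tp') gj.
rewrite enormN in gqK.
have c2K : enorm c2 <= 2 * K.
  rewrite (_ : c2 = (p + c2) - p); last by row_ring.
  by have := enormD (p + c2) (- p); rewrite enormN; lra.
have c1c2 : enorm c1 <= enorm c2 + e.
  rewrite {1}(_ : c1 = (c1 - c2) + c2); last by row_ring.
  by have := enormD (c1 - c2) c2; lra.
have pqK : enorm (p + q) <= 3 * K + 1.
  rewrite (_ : p + q = (p + q + c1) - c1); last by row_ring.
  by have := enormD (p + q + c1) (- c1); rewrite enormN; lra.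
have pqcK : enorm (p + q + c1) <= 3 * K + 1 by lra.
(* [|c2|^2 <= 8 C theta s], and [4 theta s <= (theta + s)^2] *)
have c2E : enorm c2 <= (2 * C + 1) * (theta + s).
  have C21 : 0 < 2 * C + 1 by lra.
  rewrite -(@ler_pXn2r _ 2)// ?nnegrE ?enorm_ge0 ?mulr_ge0 ?(ltW E0) ?(ltW C21)//.
  have h1 : enorm c2 ^+ 2 <= 8 * (theta * (C * s)).
    by rewrite -(ler_pM2l th0); move: c2N; rewrite epsN; lra.
  have h2 : 4 * (theta * s) <= (theta + s) ^+ 2 by have := sqr_ge0 (theta - s); nra.
  have h3 : 2 * C <= (2 * C + 1) ^+ 2 by nra.
  have h4 : 2 * C * (4 * (theta * s)) <= 2 * C * (theta + s) ^+ 2.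
    by rewrite ler_pM2l// mulr_gt0.
  have h5 : 2 * C * (theta + s) ^+ 2 <= (2 * C + 1) ^+ 2 * (theta + s) ^+ 2.
    by rewrite ler_pM2r// exprn_gt0.
  rewrite exprMn; lra.
have S1 := fsub _ _ _ _ tp fj.
have S2 := gsup _ _ _ _ tp' gj.
have S3 := wcor _ _ _ pK wj.
have S4 := GbL p (p + c2) pK gqK.
rewrite (_ : p - (p + c2) = - c2) ?enormN in S4; last by row_ring.
have S5 := GL (p + q + c1) (p + q) z pqcK pqK.
rewrite (_ : p + q + c1 - (p + q) = c1) in S5; last by row_ring.
have xz' : enorm ((theta ^+ 3)^-1 *: x - z) < r by lra.
have := Gr _ _ _ pqcK xz'.
move: S5; rewrite ler_norml ltr_norml => /andP[S5 _] /andP[S6 _].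
have S7 : ML * enorm c1 <= ML * enorm c2 + ML * (theta + s).
  by rewrite -mulrDr ler_pM2l//; lra.
have S8 : (MB + ML) * enorm c2 <= (MB + ML) * ((2 * C + 1) * (theta + s)).
  by rewrite ler_pM2l//; lra.
have S9 : 0 < C * theta by rewrite mulr_gt0.
move: ab; rewrite /C3 leNgt => /negP; apply.
lra.
Qed.

End OneSidedRate.

(** * The rate *)

Section EtaFacts.
Context {R : realType} {d : nat}.
Local Notation V := 'rV[R]_d.
Variables (H : V -> V -> R) (L : R).
Hypotheses (Ha : assumption_a H) (L0 : 0 < L).

Lemma eta_ge0 delta : 0 <= eta H L delta.
Proof.
rewrite /eta mulr_ge0//; set A := [set _ | _].
have [->|A0] := eqVneq A set0; first by rewrite inf0.
by apply: lb_le_inf => [|s [/ltW]]//; apply/set0P.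
Qed.

(** [H] is bounded on bounded sets of momenta, so twice a bound is admissible in
    the infimum defining [eta] and the infimum is approached. *)
Lemma eta_approx delta e : 0 < delta -> 0 < e -> exists s : R,
  [/\ 0 < s, (rho H L (s / (L * delta)) <= s%:E)%E & s <= eta H L delta + e].
Proof.
move=> delta0 e0; rewrite /eta; set A := [set _ | _].
have Alb : lbound A 0 by move=> s [/ltW].
have A0 : A !=set0.
  have [M M0 [HM _]] := hamiltonian_lip Ha L.
  exists (2 * M); split; first by rewrite mulr_gt0.
  apply: ge_ereal_sup => _ [y _ <-]; apply: ge_ereal_inf.
  exists (ereal_sup [set (`|H px.1 (px.2 + y) - H px.1 (px.2 + 0)|)%:E
                | px in @eball R d L `*` setT]).
    by exists 0 => //; rewrite /eball /= enorm0 divr_gt0 ?mulr_gt0.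
  apply: ge_ereal_sup => _ [[p x] [/= pL _] <-]; rewrite lee_fin.
  have := HM p (x + y) (ltW pL); have := HM p (x + 0) (ltW pL).
  have := ler_normB (H p (x + y)) (H p (x + 0)); lra.
have [s [s0 hs] se] := inf_adherent e0 (conj A0 (ex_intro _ 0 Alb)).
exists s; split=> //.
have : 0 <= inf A by exact: lb_le_inf.
lra.
Qed.

End EtaFacts.


Theorem proposition8p3 (R : realType) (d : nat) (d_gt0 : (0 < d)%N)
    (H : 'rV[R]_d -> 'rV[R]_d -> R)
    (H_cont : continuous (fun z : 'rV[R]_d * 'rV[R]_d => H z.1 z.2))
    (Ha : assumption_a H) (Hb : assumption_b H) (Hc : assumption_c H)
    (v : R -> 'rV[R]_d -> 'rV[R]_d -> R) (v_sol : cell_family H v)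
    (Hbar : 'rV[R]_d -> R) (Hbar_eff : effective_hamiltonian v Hbar)
    (u0 : 'rV[R]_d -> R) (u0_C01 : exists M : R, C01_bound setT M u0)
    (ueps : R -> 'rV[R]_d -> R -> R) (u : 'rV[R]_d -> R -> R)
    (ueps_sol : forall eps : R, 0 < eps ->
       evolution_solution (fun q x => H q (eps^-1 *: x)) (ueps eps))
    (ueps_init : forall (eps : R) (x : 'rV[R]_d), 0 < eps ->
       ueps eps x 0 = u0 x)
    (ueps_C01 : forall eps T : R, 0 < eps -> 0 < T -> C01_strip T (ueps eps))
    (u_sol : evolution_solution (fun q _ => Hbar q) u)
    (u_init : forall x : 'rV[R]_d, u x 0 = u0 x)
    (u_C01 : forall T : R, 0 < T -> C01_strip T u)
    (K : R) (K_gt0 : 0 < K)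
    (K_lip : forall (eps : R) (x y : 'rV[R]_d) (s t : R),
       0 < eps -> 0 <= s -> 0 <= t ->
       Num.max `|ueps eps x t - ueps eps y s| `|u x t - u y s|
         <= K * (enorm (x - y) + `|t - s|)) :
  exists2 C : R, 0 < C & forall T eps : R, 1 <= T -> 0 < eps ->
    (ereal_sup [set (`|ueps eps xt.1 xt.2 - u xt.1 xt.2|)%:E
               | xt in [set xt : 'rV[R]_d * R | (0 <= xt.2 <= T)%R]]
     <= (C * T * (eps `^ (1 / 3) + eta H (Lconst H K) (eps `^ (1 / 3))))%:E)%E.
Proof.
have [M [uM _]] := u0_C01.
have uepsK eps : 0 < eps -> lipschitz_t K (ueps eps).
  move=> eps0 x y s t s0 t0; apply: le_trans (K_lip eps x y s t eps0 s0 t0).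
  by rewrite le_max lexx.
have uK : lipschitz_t K u.
  move=> x y s t s0 t0; apply: le_trans (K_lip 1 x y s t ltr01 s0 t0).
  by rewrite le_max lexx orbT.
have L0 := Lconst_gt0 Ha Hb d_gt0 K_gt0.
have [SK [HS SL]] := Lconst_spec Ha Hb K_gt0.
set L := Lconst H K in L0 SL *.
have [C1 C10 corr] := corrector_error Ha K_gt0 HS SL v_sol Hbar_eff L0.
have [MB MB0 HbarL] := effective_lip Ha K_gt0 HS SL v_sol Hbar_eff.
have [ML ML0 [_ HL]] := hamiltonian_lip Ha (3 * K + 1).
pose C3 := (MB + ML) * (2 * C1 + 1) + C1 + ML + 2.
have C30 : 0 < C3.
  have : 0 < (MB + ML) * (2 * C1 + 1) by rewrite mulr_gt0//; lra.
  rewrite /C3; lra.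
have K2 : 0 < K ^+ 2 by rewrite exprn_gt0.
exists (2 * (C3 + K ^+ 2 + C1) + 2 * K); first by lra.
move=> T eps T1 eps0; apply: ge_ereal_sup => _ [[x t] /= /andP[t0 tT] <-].
rewrite lee_fin; set theta := eps `^ (1 / 3).
have th0 : 0 < theta by rewrite powR_gt0.
have thE : theta ^+ 3 = eps.
  by rewrite -powR_mulrn ?ltW// -powRrM mul1r mulVf// powRr1// ltW.
have eta0 := @eta_ge0 _ _ H L theta.
have T0 : 0 < T by lra.
have [th1|th1] := leP 1 theta.
  (* both solutions stay within [K t] of the initial datum *)
  have := uepsK eps eps0 x x 0 t (lexx 0) t0; rewrite ueps_init//.
  have := uK x x 0 t (lexx 0) t0; rewrite u_init subrr enorm0 add0r subr0 (ger0_norm t0).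
  move=> h1 h2.
  have := ler_normB (ueps eps x t - u0 x) (u x t - u0 x).
  rewrite opprB addrA subrK => h3.
  have h4 : K * t <= K * T by rewrite ler_pM2l.
  have h5 : 1 <= theta + eta H L theta by lra.
  have h6 : K * T <= K * T * (theta + eta H L theta).
    by rewrite ler_peMr// mulr_ge0// ltW.
  have h7 : 0 <= 2 * (C3 + K ^+ 2 + C1) * T * (theta + eta H L theta).
    by rewrite !mulr_ge0//; lra.
  lra.
have [s [s0 rhos seta]] := eta_approx Ha L0 th0 th0.
have epsV : eps^-1 = (theta ^+ 3)^-1 by rewrite thE.
have KK : K <= 3 * K + 1 by lra.
have finish A : A <= (C3 * t + (K ^+ 2 + C1)) * (theta + s) ->
    A <= (2 * (C3 + K ^+ 2 + C1) + 2 * K) * T * (theta + eta H L theta).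
  move=> h; apply: (le_trans h).
  have h1 : C3 * t + (K ^+ 2 + C1) <= (C3 + K ^+ 2 + C1) * T.
    have : C3 * t <= C3 * T by rewrite ler_pM2l.
    have : (K ^+ 2 + C1) * 1 <= (K ^+ 2 + C1) * T by rewrite ler_pM2l//; lra.
    lra.
  have h2 : theta + s <= 2 * (theta + eta H L theta) by lra.
  have h0 : 0 < theta + s by lra.
  apply: (le_trans (_ : _ <= (C3 + K ^+ 2 + C1) * T * (theta + s))).
    by rewrite ler_pM2r.
  apply: (le_trans (_ : _ <= (C3 + K ^+ 2 + C1) * T * (2 * (theta + eta H L theta)))).
    by rewrite ler_pM2l// mulr_gt0//; lra.
  have h7 : 0 <= 2 * K * T * (theta + eta H L theta).
    by rewrite !mulr_ge0//; lra.
  lra.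
rewrite ler_norml lerNl; apply/andP; split; apply: finish.
(* the reflected problem, see the introduction *)
- rewrite (_ : - (ueps eps x t - u x t) = - ueps eps x t - - u x t); last by ring.
  apply: (@one_sided_rate _ _ (fun x t => - ueps eps x t) (fun x t => - u x t)
    (fun p y => - v theta (- p) y) (fun q y => - H (- q) y) (fun q => - Hbar (- q))
    K M C1 ML MB theta s) => //.
  + exact/lipschitz_tN/uepsK.
  + exact/lipschitz_tN.
  + by move=> y; rewrite ueps_init// u_init.
  + by move=> y; rewrite normrN ueps_init// uM.
  + exact: ltW.
  + move=> y r q a r0 fj; rewrite -epsV.
    have fj' : subjet_t (ueps eps) y r (- q) (- a) by rewrite /subjet_t !opprK.
    have := evolution_subjet (ueps_sol _ eps0) r0 fj'; lra.
  + move=> y r q b r0 gj.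
    have gj' : superjet_t u y r (- q) (- b).
      have [B hB] := gj; exists B => y' s' s'0.
      by have := hB y' s' s'0; rewrite !opprK.
    have := evolution_superjet u_sol r0 gj'; lra.
  + move=> p pK; have [B [_ cv _ _]] := cell_family_spec v_sol (- p) th0.
    exact: (ctsN cv).
  + move=> p y z; rewrite -(enormN p) => pK.
    have [osc _] := corr theta s _ th0 s0 rhos pK.
    by rewrite opprK addrC.
  + move=> p z q; rewrite -(enormN p) => pK wj.
    have [_ err] := corr theta s _ th0 s0 rhos pK.
    have [B [_ _ _ vs]] := cell_family_spec v_sol (- p) th0.
    have wj' : superjet (v theta (- p)) z (- q).
      by have [B' hB] := wj; exists B' => y; have := hB y; rewrite !opprK.
    have := cell_superjet vs wj'; rewrite -opprD => h.
    have := err z; rewrite ler_norml => /andP[h1 _]; lra.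
  + move=> p p' y pK p'K.
    have := HL (- p') (- p) y; rewrite !enormN => /(_ p'K pK).
    rewrite (_ : - p' - - p = p - p'); last by row_ring.
    by rewrite (_ : H (- p') y - H (- p) y = - H (- p) y - - H (- p') y)//; ring.
  + move=> e e0; have [r r0 Hr] := hamiltonian_unif Ha (3 * K + 1) e0.
    exists r => // p y y' pK yr; rewrite -opprD normrN.
    by apply: Hr; rewrite ?enormN.
  + move=> p1 p2; rewrite -(enormN p1) -(enormN p2) => p1K p2K.
    have := HbarL _ _ p2K p1K.
    rewrite (_ : - p2 - - p1 = p1 - p2); last by row_ring.
    lra.
- apply: (@one_sided_rate _ _ (ueps eps) u (v theta) H Hbar
    K M C1 ML MB theta s) => //.
  + exact: uepsK.
  + by move=> y; rewrite ueps_init// u_init.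
  + by move=> y; rewrite ueps_init// uM.
  + exact: ltW.
  + move=> y r q a r0 fj; rewrite -epsV.
    exact: (evolution_superjet (ueps_sol _ eps0) r0 fj).
  + move=> y r q b r0 gj; exact: (evolution_subjet u_sol r0 gj).
  + by move=> p pK; have [B [_ cv _ _]] := cell_family_spec v_sol p th0.
  + by move=> p y z pK; have [osc _] := corr theta s p th0 s0 rhos pK.
  + move=> p z q pK wj.
    have [_ err] := corr theta s _ th0 s0 rhos pK.
    have [B [_ _ _ vs]] := cell_family_spec v_sol p th0.
    have := cell_subjet vs wj => h.
    have := err z; rewrite ler_norml => /andP[_ h1]; lra.
  + by move=> e e0; exact: hamiltonian_unif.
Qed.
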